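(* Let $\Omega\subset\mathbb{R}$ be an open set and let $f:\Omega\times\mathbb{R}\times\mathbb{R}\to[0,+\infty)$, $(x,s,\xi)\mapsto f(x,s,\xi)$, satisfy: (H1) $f$ is continuous on $\Omega\times\mathbb{R}\times\mathbb{R}$, and for every $(x,s)\in\Omega\times\mathbb{R}$ the map $\xi\mapsto f(x,s,\xi)$ is convex on $\mathbb{R}$; (H2) the partial derivative $f_\xi(x,s,\xi)=\frac{\partial f}{\partial\xi}(x,s,\xi)$ exists and is continuous on $\Omega\times\mathbb{R}\times\mathbb{R}$, and on every compact set $\Omega'\times H\times K\subset\Omega\times\mathbb{R}\times\mathbb{R}$ it is absolutely continuous in $x$, uniformly in $(s,\xi)$: for every $\varepsilon>0$ there is $\delta>0$ such that for every $(s,\xi)\in H\times K$ and every finite family of pairwise disjoint open intervals $(a_i,b_i)\subset\Omega'$, $i=1,\dots,N$, with $\sum_{i}(b_i-a_i)<\delta$, one has $\sum_{i}|f_\xi(b_i,s,\xi)-f_\xi(a_i,s,\xi)|<\varepsilon$; (H3) for every compact set $K_1\subset\Omega\times\mathbb{R}$ there is a constant $L_1=L_1(K_1)$ such that $|f_\xi(x,s,\xi)|\le L_1$ for all $(x,s)\in K_1$, $\xi\in\mathbb{R}$, and $|f_\xi(x,s,\xi_1)-f_\xi(x,s,\xi_2)|\le L_1|\xi_1-\xi_2|$ for all $(x,s)\in K_1$, $\xi_1,\xi_2\in\mathbb{R}$. Then the functional $F(u,\Omega)=\int_\Omega f(x,u(x),u'(x))\,dx$ is lower semicontinuous on $W^{1,1}_{loc}(\Omega)$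 with respect to strong convergence in $L^1_{loc}(\Omega)$: whenever $u_m,u\in W^{1,1}_{loc}(\Omega)$ and $u_m\to u$ in $L^1_{loc}(\Omega)$, we have $\liminf_{m\to\infty}F(u_m,\Omega)\ge F(u,\Omega)$.
   Context: $W^{1,1}_{loc}(\Omega)$ denotes the functions $u\in L^1_{loc}(\Omega)$ whose weak derivative $u'$ lies in $L^1_{loc}(\Omega)$. Convergence $u_m\to u$ in $L^1_{loc}(\Omega)$ means $\|u_m-u\|_{L^1(K)}\to0$ for every compact $K\subset\Omega$. The integral $F(u,\Omega)$ takes values in $[0,+\infty]$. *)

(* Defs.v *)
From HB Require Import structures.
From mathcomp Require Import all_boot all_order all_algebra.
From mathcomp Require Import all_classical all_reals all_analysis.
Set Implicit Arguments. Unset Strict Implicit. Unset Printing Implicit Defensive.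
Import Order.TTheory GRing.Theory Num.Theory.
Import numFieldNormedType.Exports.
Local Open Scope classical_set_scope.
Local Open Scope ring_scope.

Definition fxi (R : realType) (f : R -> R -> R -> R) (x s xi : R) : R :=
  derive1 (f x s) xi.

Definition loc_integrable (R : realType) (Omega : set R) (u : R -> R) : Prop :=
  forall K : set R, compact K -> K `<=` Omega ->
    (@lebesgue_measure R).-integrable K (fun x => (u x)%:E).

Definition test_fun (R : realType) (Omega : set R) (phi : R -> R) : Prop :=
  (forall (n : nat) (x : R), derivable (derive1n n phi) x 1) /\
  exists C : set R, [/\ compact C, C `<=` Omega & forall x, ~ C x -> phi x = 0].

Definition W11loc_with_deriv (R : realType) (Omega : set R) (u du : R -> R) : Prop :=
  [/\ loc_integrable Omega u, loc_integrable Omega du &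
    forall phi, test_fun Omega phi ->
      (\int[@lebesgue_measure R]_(x in Omega) (u x * derive1 phi x)%R%:E
       = - \int[@lebesgue_measure R]_(x in Omega) (du x * phi x)%R%:E)%E].

Definition cvg_L1loc (R : realType) (Omega : set R) (um : nat -> R -> R) (u : R -> R) : Prop :=
  forall K : set R, compact K -> K `<=` Omega ->
    let I := (fun m : nat => (\int[@lebesgue_measure R]_(x in K) (`|um m x - u x|%R)%:E)%E) in
    (I @ \oo --> (0 : \bar R)).

Definition Ffun (R : realType) (f : R -> R -> R -> R) (Omega : set R) (u du : R -> R) : \bar R :=
  \int[@lebesgue_measure R]_(x in Omega) (f x (u x) (du x))%:E.

(* Main.v *)
Require Import Defs.
From HB Require Import structures.
From mathcomp Require Import all_boot all_order all_algebra.
From mathcomp Require Import all_classical all_reals all_analysis.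
From mathcomp Require Import measurable_realfun ring lra.
Set Implicit Arguments. Unset Strict Implicit. Unset Printing Implicit Defensive.
Import Order.TTheory GRing.Theory Num.Theory.
Import numFieldNormedType.Exports.
Local Open Scope classical_set_scope.
Local Open Scope ring_scope.

(** On an interval where a slope [xi] is frozen, convexity bounds [f x v v'] below by its
    tangent at [xi], and the only delicate term of the bound is the integral of
    [g x v * v'], where [g] is [fxi f] at [xi] times cutoffs in [x] and [s].  This
    functional is continuous in L1 along absolutely continuous [v].  On a fine grid it is
    close to the sum of the integrals of [g x_i] from [v x_i] to [v x_(i+1)]; summation by
    parts at each level [t] compares two functions [u] and [v] through the increments
    [g x_(i+1) t - g x_i t] alone, over the cells at whose right end [t] lies between [u]
    and [v].  Absolute continuity bounds their sum by [e] plus a multiple of the total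
    length of those cells, and integrating in [t] turns the length into the L1 distance of
    [u] and [v].  No bound on the derivatives of [v] is used.  Approximating the derivative
    of the limit by step functions, and exhausting [Omega] by finite unions of intervals,
    gives the theorem. *)

(** * Primitives and grids *)

(** The obstacle is the dependence on [x]: a primitive of [g x] in [s] need not be differentiable in
    [x], so no chain rule along [v] is at hand, and finite differences on a grid stand in for it.
    The mesh may depend on [v], because the constants of the final estimate come from the variation
    of [g] alone; this makes the estimate uniform along the sequence. Each cutoff answers a lack of
    control on [v]. The L1 distance says nothing about values at the ends of the interval, and the
    cutoff in [x] removes the boundary terms of the summation by parts. There is no uniform bound on
    [|v|] either, and the cutoff in [s] confines the levels [t] to a compact set on which the
    hypotheses are uniform. Both cutoffs lie in [[0, 1]] and [f >= 0], so the tangent multiplied by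
    them still bounds the energy of [v] from below; on the side of the limit they cost only a small
    loss near the ends. Since slopes are bounded uniformly in [xi], freezing the derivative of the
    limit costs a multiple of an L1 distance, so approximation in L1 is enough. *)

Section primitives.
Context {R : realType}.
Local Notation mu := (@lebesgue_measure R).
Implicit Types (a b c x y e : R) (u v w z f : R -> R).

Lemma integrable_scale (D : set (measurableTypeR R)) c f : measurable D ->
  mu.-integrable D (EFin \o f) -> mu.-integrable D (EFin \o (fun x => c * f x)).
Proof. by move=> mD fi; exact: (integrableZl mD c fi). Qed.

Lemma integrable_plus (D : set (measurableTypeR R)) f v : measurable D ->
  mu.-integrable D (EFin \o f) -> mu.-integrable D (EFin \o v) ->
  mu.-integrable D (EFin \o (fun x => f x + v x)).
Proof. by move=> mD fi vi; exact: (integrableD mD fi vi). Qed.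

Lemma integrable_minus (D : set (measurableTypeR R)) f v : measurable D ->
  mu.-integrable D (EFin \o f) -> mu.-integrable D (EFin \o v) ->
  mu.-integrable D (EFin \o (fun x => f x - v x)).
Proof. by move=> mD fi vi; exact: (integrableB mD fi vi). Qed.

Lemma integrable_abs (D : set (measurableTypeR R)) f :
  mu.-integrable D (EFin \o f) -> mu.-integrable D (EFin \o (fun x => `|f x|)).
Proof. exact: integrable_norm. Qed.

Lemma Rintegral_abs_le (D : set (measurableTypeR R)) f v : measurable D ->
  mu.-integrable D (EFin \o f) -> mu.-integrable D (EFin \o v) ->
  (forall x, D x -> `|f x| <= v x) ->
  `|\int[mu]_(x in D) f x| <= \int[mu]_(x in D) v x.
Proof.
move=> mD fi vi fv; apply: le_trans (le_normr_Rintegral mD fi) _.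
by apply: le_Rintegral => //; exact: integrable_abs.
Qed.

Lemma mu_itvoc a b : a <= b -> fine (mu `]a, b]) = b - a.
Proof.
move=> ab; rewrite lebesgue_measure_itv/= lte_fin.
have [//|] := ltP a b; move=> ba.
by rewrite /=; lra.
Qed.

Lemma mu_itvoc_fin a b : (mu `]a, b] < +oo)%E.
Proof.
by rewrite lebesgue_measure_itv/=; case: ifP => _; rewrite ?ltry// -EFinB ltry.
Qed.

Lemma integrable_itvoc_sub a b x y f : a <= x -> y <= b ->
  mu.-integrable `]a, b] (EFin \o f) -> mu.-integrable `]x, y] (EFin \o f).
Proof.
move=> ax yb; apply: integrableS => //.
by move=> t /=; rewrite !in_itv/= => /andP[xt ty]; rewrite (le_lt_trans ax xt) (le_trans ty yb).
Qed.

Lemma Rintegral_itvoc_cat a x b f : a <= x -> x <= b ->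
  mu.-integrable `]a, b] (EFin \o f) ->
  \int[mu]_(t in `]a, b]) f t =
  \int[mu]_(t in `]a, x]) f t + \int[mu]_(t in `]x, b]) f t.
Proof.
move=> ax xb fi.
have -> : `]a, b]%classic = `]a, x] `|` `]x, b].
  by rewrite -itv_bndbnd_setU// bnd_simp.
rewrite Rintegral_setU//.
  by rewrite -itv_bndbnd_setU// bnd_simp.
apply/disj_setPS => t [/=]; rewrite !in_itv/= => /andP[_ tx] /andP[xt _].
by have := lt_le_trans xt tx; rewrite ltxx.
Qed.

Lemma Rintegral_sum_ord d (T : measurableType d) (nu : {measure set T -> \bar R})
    (D : set T) N (F : nat -> T -> R) : measurable D ->
  (forall i, (i < N)%N -> nu.-integrable D (EFin \o F i)) ->
  nu.-integrable D (EFin \o (fun t => \sum_(i < N) F i t)) /\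
  \int[nu]_(t in D) (\sum_(i < N) F i t) = \sum_(i < N) \int[nu]_(t in D) F i t.
Proof.
move=> mD; elim: N => [|N IH] Fi.
  split.
    apply: (eq_integrable mD _ _ _ (integrable0 nu D)) => t _ /=.
    by rewrite big_ord0.
  rewrite big_ord0 (@eq_Rintegral _ _ _ _ _ (cst 0)); last by move=> t _; rewrite big_ord0.
  by rewrite Rintegral_cst// mul0r.
have [|I1 I2] := IH.
  by move=> i iN; apply: Fi; rewrite ltnS ltnW.
have E : (fun t => \sum_(i < N.+1) F i t) = (fun t => \sum_(i < N) F i t + F N t).
  by apply/funext => t; rewrite big_ord_recr.
rewrite E; split.
  exact: (integrableD mD I1 (Fi N (ltnSn N))).
by rewrite RintegralD// ?I2 ?big_ord_recr//; exact: Fi.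
Qed.

Definition grid a h (i : nat) : R := a + h *+ i.

Lemma grid0 a h : grid a h 0 = a. Proof. by rewrite /grid mulr0n addr0. Qed.

Lemma gridS a h i : grid a h i.+1 = grid a h i + h.
Proof. by rewrite /grid mulrSr addrA. Qed.

Lemma grid_le a h i j : 0 <= h -> (i <= j)%N -> grid a h i <= grid a h j.
Proof. by move=> h0 ij; rewrite /grid lerD2l ler_wpMn2l. Qed.

Lemma grid_end a b N : (0 < N)%N -> grid a ((b - a) / N%:R) N = b.
Proof.
move=> N0; rewrite /grid -[_ / _ *+ N]mulr_natr mulfVK ?pnatr_eq0 ?gtn_eqF//; lra.
Qed.

Lemma Rintegral_grid a h N f : 0 <= h ->
  mu.-integrable `]a, grid a h N] (EFin \o f) ->
  \int[mu]_(t in `]a, grid a h N]) f t =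
  \sum_(i < N) \int[mu]_(t in `]grid a h i, grid a h i.+1]) f t.
Proof.
move=> h0; elim: N => [|N IH] fi.
  by rewrite big_ord0 grid0 set_itv_ge ?bnd_simp ?lexx ?Rintegral_set0// ltxx.
have le1 := @grid_le a h _ _ h0 (leqnSn N).
have le0 := @grid_le a h _ _ h0 (leq0n N); rewrite grid0 in le0.
rewrite (Rintegral_itvoc_cat le0 le1 fi) IH ?big_ord_recr//.
exact: integrable_itvoc_sub fi.
Qed.

(** Absolute continuity of [u] with derivative [w], encoded by the integral identity between any two
    points, so that nothing has to be differentiated. Half-open intervals let adjacent cells tile
    without overlap. *)
Definition primitive_on a b u w :=
  mu.-integrable `]a, b] (EFin \o w) /\
  forall x y, a <= x -> x <= y -> y <= b -> u y - u x = \int[mu]_(t in `]x, y]) w t.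

Lemma primitive_on_sub a b x y u w : a <= x -> y <= b ->
  primitive_on a b u w -> primitive_on x y u w.
Proof.
move=> ax yb [wi uw]; split; first exact: integrable_itvoc_sub wi.
by move=> s t xs st ty; apply: uw => //; [exact: le_trans xs|exact: le_trans yb].
Qed.

Lemma primitive_on_dist a b u w x y : primitive_on a b u w ->
  a <= x -> x <= y -> y <= b ->
  `|u y - u x| <= \int[mu]_(t in `]x, y]) `|w t|.
Proof.
move=> [wi uw] ax xy yb; rewrite uw//; apply: le_normr_Rintegral => //.
exact: integrable_itvoc_sub wi.
Qed.

Lemma primitive_on_unif a b u w : primitive_on a b u w -> forall e : R, 0 < e ->
  exists2 d : R, 0 < d & forall x y, a <= x <= b -> a <= y <= b -> `|x - y| < d ->
    `|u x - u y| < e.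
Proof.
move=> uwP e e0; have [wi uw] := uwP.
(* Absolute continuity of the integral is applied on the whole line, hence the extension of [w] by
   zero. *)
have wi' : mu.-integrable setT (EFin \o (w \_ `]a, b])).
  by rewrite -restrict_EFin; apply/integrable_restrict => //; rewrite setTI.
have [d [d0 Hd]] := integral_normr_continuous wi' e0.
exists d => // x y.
wlog xy : x y / y <= x.
  move=> H xab yab xyd; have [xy|/ltW xy] := leP y x; first exact: H.
  by rewrite distrC; apply: H => //; rewrite distrC.
move=> /andP[ax xb] /andP[ay yb]; rewrite ger0_norm ?subr_ge0// => xyd.
apply: (le_lt_trans (primitive_on_dist uwP ay xy xb)).
have [{}xy|yx] := ltP y x; last first.
  by rewrite set_itv_ge ?bnd_simp -?leNgt// Rintegral_set0.
have : (mu `]y, x] < d%:E)%E.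
  by rewrite lebesgue_measure_itv/= lte_fin xy -EFinD lte_fin.
move=> /(Hd _ (measurable_itv _)); apply: le_lt_trans.
rewrite le_eqVlt; apply/orP; left; apply/eqP; apply: eq_Rintegral => t.
rewrite inE/= in_itv/= => /andP[yt tx]; rewrite patchE mem_set//=.
by rewrite in_itv/= (le_lt_trans ay yt) (le_trans tx xb).
Qed.

Lemma unif_continuous_itv a b u :
  (forall e : R, 0 < e -> exists2 d : R, 0 < d & forall x y, a <= x <= b ->
    a <= y <= b -> `|x - y| < d -> `|u x - u y| < e) ->
  {within `[a, b], continuous u}.
Proof.
move=> H; apply/subspace_continuousP => x /=; rewrite in_itv/= => xab.
apply/cvgrPdist_lt => e e0; have [d d0 Hd] := H e e0.
rewrite near_withinE; near=> y => /=; rewrite in_itv/= => yab.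
apply: Hd => //; near: y; apply/nbhs_ballP; exists d => //= y.
Unshelve. all: by end_near. Qed.

Lemma within_measurable_itvoc a b u : {within `[a, b], continuous u} ->
  measurable_fun `]a, b] u.
Proof.
move=> uc; have : measurable_fun `[a, b] u.
  exact: subspace_continuous_measurable_fun.
apply: measurable_funS => //; exact: subset_itv_oc_cc.
Qed.

Lemma within_integrable_itvoc a b u : {within `[a, b], continuous u} ->
  mu.-integrable `]a, b] (EFin \o u).
Proof.
move=> uc; have I1 := continuous_compact_integrable (@segment_compact _ a b) uc.
by apply: integrableS I1 => //; exact: subset_itv_oc_cc.
Qed.

Lemma primitive_on_continuous a b u w : primitive_on a b u w ->
  {within `[a, b], continuous u}.
Proof. by move=> uw; apply: unif_continuous_itv; exact: primitive_on_unif uw. Qed.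

Lemma bounded_integrable_itvoc a b f M : measurable_fun `]a, b] f ->
  (forall x, a < x <= b -> `|f x| <= M) -> mu.-integrable `]a, b] (EFin \o f).
Proof.
move=> mf fM; apply: measurable_bounded_integrable => //.
  exact: mu_itvoc_fin.
exists M; split; first exact: num_real.
by move=> N MN x; rewrite /= in_itv/= => xab; exact: le_trans (fM x xab) (ltW MN).
Qed.

Lemma integrable_itvoc_bddM a b (h : R -> R) f M : measurable_fun `]a, b] h ->
  (forall x, a < x <= b -> `|h x| <= M) -> mu.-integrable `]a, b] (EFin \o f) ->
  mu.-integrable `]a, b] (EFin \o (fun x => h x * f x)).
Proof.
move=> mh hM fi.
have hb : [bounded h x | x in `]a, b]%classic].
  exists M; split; first exact: num_real.
  by move=> N MN x; rewrite /= in_itv/= => xab; exact: le_trans (hM x xab) (ltW MN).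
exact: (@integrableMr _ _ _ mu _ (measurable_itv _) _ _ mh hb fi).
Qed.

Lemma primitive_on_integral a b c f : mu.-integrable `]a, b] (EFin \o f) ->
  primitive_on a b (fun x => c + \int[mu]_(t in `]a, x]) f t) f.
Proof.
move=> fi; split => // x y ax xy yb.
rewrite (Rintegral_itvoc_cat ax xy); first by ring.
exact: integrable_itvoc_sub fi.
Qed.

End primitives.

(** * Continuity of the pairing of a slope with a derivative *)

Section step_functions.
Context {R : realType}.
Local Notation mu := (@lebesgue_measure R).
Implicit Types u v t : R.

(* [below u - below v] is a signed indicator of the interval between [u] and [v]; its
   integral against [g x] is the increment of a primitive of [g x] from [v] to [u]. *)
Definition below (s t : R) : R := (t < s)%R%:R.

Lemma below_indic u v t : v <= u -> below u t - below v t = \1_(`[v, u[%classic) t.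
Proof.
move=> vu; rewrite /below indicE mem_setE in_itv/=.
by case: (ltP t v) => tv; case: (ltP t u) => tu; rewrite /= ?subrr ?subr0//; lra.
Qed.

Lemma below_integral u v :
  mu.-integrable setT (EFin \o (fun t => below u t - below v t)) /\
  \int[mu]_t (below u t - below v t) = u - v.
Proof.
wlog vu : u v / v <= u.
  move=> H; have [vu|/ltW uv] := leP v u; first exact: H.
  have [I1 I2] := H _ _ uv.
  have E : (fun t => below u t - below v t) = (fun t => -1 * (below v t - below u t)).
    by apply/funext => t; ring.
  rewrite E; split; first exact: (integrableZl measurableT (-1) I1).
  by rewrite RintegralZl// I2; ring.
have E : (fun t => below u t - below v t) = \1_(`[v, u[%classic).
  by apply/funext => t; rewrite below_indic.
rewrite E; split; first exact: integrable_indic_itv.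
rewrite /Rintegral integral_indic// setIT.
transitivity (fine (mu `[v, u[)) => //; rewrite lebesgue_measure_itv/= lte_fin.
by case: ltP => //= uv; lra.
Qed.

Lemma below_integral_norm u v :
  mu.-integrable setT (EFin \o (fun t => `|below u t - below v t|)) /\
  \int[mu]_t `|below u t - below v t| = `|u - v|.
Proof.
have [I1 I2] := below_integral u v.
split; first exact: integrable_norm I1.
wlog vu : u v I1 I2 / v <= u.
  move=> H; have [vu|/ltW uv] := leP v u; first exact: H.
  have [J1 J2] := below_integral v u.
  rewrite distrC -(H _ _ J1 J2 uv); apply: eq_Rintegral => t _; exact: distrC.
rewrite [RHS]ger0_norm ?subr_ge0// -I2; apply: eq_Rintegral => t _.
by rewrite ger0_norm// below_indic// indicE ler0n.
Qed.

Lemma below_between u v t : below u t - below v t != 0 -> Num.min u v <= t <= Num.max u v.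
Proof.
rewrite /below; case: (ltP t u) => tu; case: (ltP t v) => tv; rewrite ?subrr ?eqxx// => _.
  by rewrite ge_min tv orbT le_max (ltW tu).
by rewrite ge_min tu le_max (ltW tv) orbT.
Qed.

End step_functions.

(** * Riemann sums of the pairing and summation by parts *)

Section stieltjes_pairing.
Context {R : realType} (a b T B : R) (g : R -> R -> R).
Local Notation mu := (@lebesgue_measure R).
Hypothesis ab : a < b.
Hypothesis T0 : 0 <= T.
Hypothesis g_supp : forall x s, a <= x <= b -> T < `|s| -> g x s = 0.
Hypothesis g_bd : forall x s, a <= x <= b -> `|g x s| <= B.
Hypothesis g_uc : forall e : R, 0 < e -> exists2 d : R, 0 < d &
  forall x y s t, a <= x <= b -> a <= y <= b -> `|x - y| < d -> `|s - t| < d ->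
    `|g x s - g y t| < e.
Hypothesis g_a : forall s, g a s = 0.
Hypothesis g_b : forall s, g b s = 0.
(** [P] is arbitrary because it will select the cells at whose right end the level [t] separates the
    two functions. [C] and [h0] depend on [e] only, not on [N], [t] or [P], which is what allows
    integration in [t]. *)
Hypothesis g_var : forall e : R, 0 < e -> exists C h0 : R, [/\ 0 <= C, 0 < h0 &
  forall N, (0 < N)%N -> let h := (b - a) / N%:R in h < h0 ->
  forall (t : R) (P : pred nat),
    \sum_(i < N | P i) `|g (grid a h i.+1) t - g (grid a h i) t| <=
    e + \sum_(i < N | P i) C * h].

Lemma g_slice_measurable x : a <= x <= b -> measurable_fun setT (g x).
Proof.
move=> xab; apply: continuous_measurable_fun => s.
apply/cvgrPdist_lt => e e0; have [d d0 Hd] := g_uc e0.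
apply/nbhs_ballP; exists d => //= t st; apply: Hd => //; by rewrite subrr normr0.
Qed.

Lemma below_slice_integrable x u v : a <= x <= b ->
  mu.-integrable setT (EFin \o (fun t => (below u t - below v t) * g x t)).
Proof.
move=> xab; have [I _] := below_integral u v.
apply: (integrableMl measurableT I (g_slice_measurable xab)).
exists B; split; first exact: num_real.
by move=> N MN t _; exact: le_trans (g_bd t xab) (ltW MN).
Qed.

Lemma comp_unif u w : primitive_on a b u w ->
  forall e : R, 0 < e -> exists2 d : R, 0 < d & forall x y, a <= x <= b ->
    a <= y <= b -> `|x - y| < d -> `|g x (u x) - g y (u y)| < e.
Proof.
move=> uw e e0; have [d d0 Hd] := g_uc e0.
have [d' d'0 Hd'] := primitive_on_unif uw d0.
exists (Num.min d d'); first by rewrite lt_min d0 d'0.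
by move=> x y xab yab; rewrite lt_min => /andP[xy1 xy2]; apply: Hd => //; exact: Hd'.
Qed.

Lemma comp_integrable u w : primitive_on a b u w ->
  mu.-integrable `]a, b] (EFin \o (fun x => g x (u x) * w x)).
Proof.
move=> uw; have [wi _] := uw.
have mg : measurable_fun `]a, b] (fun x => g x (u x)).
  by apply: within_measurable_itvoc; apply: unif_continuous_itv; exact: comp_unif uw.
apply: (integrable_itvoc_bddM mg _ wi) => x /andP[ax xb].
by apply: g_bd; rewrite (ltW ax) xb.
Qed.

(** Both integrals are compared with [c * (u y - u x)] for [c = g x (u x)], each at the cost of [om]
    times the integral of [|w|]. In the first one only levels between [u x] and [u y] count, and
    these are within [d] of [u x]. *)
Lemma piece_approx u w x y (om d : R) : primitive_on a b u w ->
  0 <= om -> a <= x -> x <= y -> y <= b ->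
  (forall s t, x <= s <= y -> `|u x - t| < d -> `|g s t - g x (u x)| <= om) ->
  (forall s, x <= s <= y -> `|u x - u s| < d) ->
  `|\int[mu]_t ((below (u y) t - below (u x) t) * g x t) -
    \int[mu]_(t in `]x, y]) (g t (u t) * w t)| <=
  2 * om * \int[mu]_(t in `]x, y]) `|w t|.
Proof.
move=> uw om0 ax xy yb gom uom; have [wi uwE] := uw.
have xab : a <= x <= b by rewrite ax (le_trans xy yb).
have wixy : mu.-integrable `]x, y] (EFin \o w) by exact: integrable_itvoc_sub wi.
have nwi := integrable_abs wixy.
set c := g x (u x).
have [I1 I2] := below_integral (u y) (u x).
have [J1 J2] := below_integral_norm (u y) (u x).
have e1 : \int[mu]_t ((below (u y) t - below (u x) t) * g x t) - c * (u y - u x) =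
   \int[mu]_t ((below (u y) t - below (u x) t) * g x t - c * (below (u y) t - below (u x) t)).
  rewrite RintegralB//; last exact: (integrable_scale c measurableT I1).
    by rewrite RintegralZl// I2.
  exact: below_slice_integrable.
have gi : mu.-integrable `]x, y] (EFin \o (fun t => g t (u t) * w t)).
  by apply: integrable_itvoc_sub (comp_integrable uw).
have cwi := integrable_scale c (measurable_itv _) wixy.
have e2 : \int[mu]_(t in `]x, y]) (g t (u t) * w t) - c * (u y - u x) =
   \int[mu]_(t in `]x, y]) (g t (u t) * w t - c * w t).
  by rewrite RintegralB// uwE// RintegralZl.
have -> : forall p q : R, p - q = (p - c * (u y - u x)) - (q - c * (u y - u x)).
  by move=> p q; ring.
rewrite e1 e2; apply: le_trans (ler_normB _ _) _.
have i1 : mu.-integrable setT (EFin \o (fun t =>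
    (below (u y) t - below (u x) t) * g x t - c * (below (u y) t - below (u x) t))).
  apply: (integrable_minus measurableT (below_slice_integrable _ _ xab)).
  exact: (integrable_scale c measurableT I1).
have i2 := integrable_minus (measurable_itv _) gi cwi.
have h1 : `|\int[mu]_t ((below (u y) t - below (u x) t) * g x t -
    c * (below (u y) t - below (u x) t))| <= om * \int[mu]_(t in `]x, y]) `|w t|.
  apply: (le_trans (le_normr_Rintegral measurableT i1)).
  apply: (@le_trans _ _ (om * `|u y - u x|)); last first.
    by rewrite ler_wpM2l// (primitive_on_dist uw).
  rewrite -J2 -RintegralZl//; apply: le_Rintegral => //.
  - exact: integrable_abs i1.
  - exact: (integrable_scale om measurableT J1).
  move=> t _; rewrite [c * _]mulrC -mulrBr normrM mulrC.
  have [->|nz] := eqVneq (below (u y) t - below (u x) t) 0; first by rewrite normr0 !mulr0.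
  apply: ler_wpM2r => //; apply: gom; first by rewrite lexx xy.
  have := uom y; rewrite xy lexx => /(_ isT).
  have /andP[] := below_between nz.
  by rewrite ge_min le_max => /orP[] ? /orP[] ?; rewrite !ltr_norml; lra.
have h2 : `|\int[mu]_(t in `]x, y]) (g t (u t) * w t - c * w t)| <=
    om * \int[mu]_(t in `]x, y]) `|w t|.
  rewrite -RintegralZl//; apply: Rintegral_abs_le => //.
    exact: (integrable_scale om (measurable_itv _) nwi).
  move=> t; rewrite /= in_itv/= => /andP[xt ty].
  rewrite -mulrBl normrM; apply: ler_wpM2r => //.
  by apply: gom; [rewrite (ltW xt) ty|apply: uom; rewrite (ltW xt) ty].
by apply: le_trans (lerD h1 h2) _; rewrite -mulrA mulr_natl mulr2n.
Qed.

Lemma step_gt0 N : (0 < N)%N -> 0 < (b - a) / N%:R.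
Proof. by move=> N0; rewrite divr_gt0 ?subr_gt0 ?ltr0n. Qed.

Lemma grid_in N i : (0 < N)%N -> (i <= N)%N -> a <= grid a ((b - a) / N%:R) i <= b.
Proof.
move=> N0 iN; have h0 := ltW (step_gt0 N0).
have := grid_le a h0 (leq0n i); rewrite grid0 => ->.
by have := grid_le a h0 iN; rewrite grid_end.
Qed.

Lemma grid_unif (d : R) N i x y :
  let h := (b - a) / N%:R in (0 < N)%N -> h < d ->
  grid a h i <= x <= grid a h i.+1 -> grid a h i <= y <= grid a h i.+1 ->
  `|x - y| < d.
Proof.
move=> h N0 hd; rewrite gridS => /andP[? ?] /andP[? ?].
by rewrite ltr_norml; apply/andP; split; lra.
Qed.

(** Each integral between two values of [u] is written over the whole line against a signed
    indicator, so that two such sums can be compared level by level under a single integral. *)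
Definition riemann_pairing (u : R -> R) N :=
  let x := grid a ((b - a) / N%:R) in
  \sum_(i < N) \int[mu]_t ((below (u (x i.+1)) t - below (u (x i)) t) * g (x i) t).

Lemma riemann_pairing_cvg u w : primitive_on a b u w ->
  forall e : R, 0 < e -> exists2 h0 : R, 0 < h0 & forall N, (0 < N)%N ->
    (b - a) / N%:R < h0 ->
    `|riemann_pairing u N - \int[mu]_(x in `]a, b]) (g x (u x) * w x)| <= e.
Proof.
move=> uw e e0; have [wi _] := uw.
set W := \int[mu]_(t in `]a, b]) `|w t|.
have W0 : 0 <= W by apply: Rintegral_ge0.
(* The cells contribute [2 * om * W] altogether; the added [1] allows [W = 0]. *)
pose om := e / (2 * W + 1).
have om0 : 0 < om by rewrite divr_gt0//; lra.
have [d d0 Hd] := g_uc om0; have [d' d'0 Hd'] := primitive_on_unif uw d0.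
exists (Num.min d d'); first by rewrite lt_min d0 d'0.
move=> N N0; set h := (b - a) / N%:R; rewrite lt_min => /andP[hd hd'].
have h0 : 0 <= h by exact/ltW/step_gt0.
have gE : grid a h N = b by exact: grid_end.
have := @Rintegral_grid _ a h N _ h0; rewrite gE => RG.
rewrite (RG _ (comp_integrable uw)).
rewrite /riemann_pairing -/h -sumrB.
apply: (le_trans (ler_norm_sum _ _ _)).
apply: (@le_trans _ _ (\sum_(i < N) 2 * om * \int[mu]_(t in `]grid a h i, grid a h i.+1]) `|w t|)).
  apply: ler_sum => i _.
  have /andP[ax xb] := grid_in N0 (ltnW (ltn_ord i)).
  have /andP[ay yb] := grid_in N0 (ltn_ord i).
  have xy : grid a h i <= grid a h i.+1 by exact: grid_le.
  apply: (piece_approx (d := d) uw (ltW om0) ax xy yb).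
    move=> s t /andP[xs sy] ut; apply/ltW; apply: Hd.
    - by rewrite (le_trans ax xs) (le_trans sy yb).
    - by rewrite ax xb.
    - by apply: (grid_unif N0 hd (i := i)); rewrite ?lexx ?xs ?sy ?xy.
    - by rewrite distrC.
  move=> s /andP[xs sy]; apply: Hd'.
  - by rewrite ax xb.
  - by rewrite (le_trans ax xs) (le_trans sy yb).
  - by apply: (grid_unif N0 hd' (i := i)); rewrite ?lexx ?xs ?sy ?xy.
rewrite -mulr_sumr -RG; last exact: integrable_abs.
rewrite -/W /om.
have -> : 2 * (e / (2 * W + 1)) * W = e * ((2 * W) / (2 * W + 1)) by ring.
rewrite -[leRHS]mulr1 ler_wpM2l ?(ltW e0)// ler_pdivrMr; lra.
Qed.

Lemma primitive_diff_integrable u w v z : primitive_on a b u w -> primitive_on a b v z ->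
  mu.-integrable `]a, b] (EFin \o (fun x => `|u x - v x|)).
Proof.
move=> uw vz; have cu := primitive_on_continuous uw.
have cv := primitive_on_continuous vz.
by apply: integrable_abs; apply: integrable_minus => //; exact: within_integrable_itvoc.
Qed.

(** Right ends are sampled because these are what summation by parts leaves. On a cell [u] and [v]
    each vary by at most [om], so the sum is off by at most [2 * om * (b - a) = e]. *)
Lemma riemann_sum_dist u w v z : primitive_on a b u w -> primitive_on a b v z ->
  forall e : R, 0 < e -> exists2 h0 : R, 0 < h0 & forall N, (0 < N)%N ->
    let h := (b - a) / N%:R in h < h0 ->
    \sum_(i < N) h * `|u (grid a h i.+1) - v (grid a h i.+1)| <=
    \int[mu]_(x in `]a, b]) `|u x - v x| + e.
Proof.
move=> uw vz e e0; have di := primitive_diff_integrable uw vz.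
pose om := e / (2 * (b - a)).
have om0 : 0 < om by rewrite divr_gt0// mulr_gt0// subr_gt0.
have [d d0 Hd] := primitive_on_unif uw om0.
have [d' d'0 Hd'] := primitive_on_unif vz om0.
exists (Num.min d d'); first by rewrite lt_min d0 d'0.
move=> N N0 h; rewrite lt_min => /andP[hd hd'].
have h0 : 0 <= h by exact/ltW/step_gt0.
have gE : grid a h N = b by exact: grid_end.
have -> : e = \sum_(i < N) h * (2 * om).
  rewrite sumr_const card_ord -[_ *+ N]mulr_natr /om /h.
  field; rewrite subr_eq0 pnatr_eq0 gt_eqF// -lt0n N0//.
have := @Rintegral_grid _ a h N _ h0; rewrite gE => RG.
rewrite (RG _ di) -big_split/=.
apply: ler_sum => i _.
have /andP[ax xb] := grid_in N0 (ltnW (ltn_ord i)).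
have /andP[ay yb] := grid_in N0 (ltn_ord i).
have xy : grid a h i <= grid a h i.+1 by exact: grid_le.
set x := grid a h i in ax xb xy *; set y := grid a h i.+1 in ay yb xy *.
have hE : fine (mu `]x, y]) = h by rewrite mu_itvoc// /x /y gridS; ring.
have dixy : mu.-integrable `]x, y] (EFin \o (fun x => `|u x - v x|)).
  exact: integrable_itvoc_sub di.
have ci (c : R) : mu.-integrable `]x, y] (EFin \o cst c).
  by apply: (@bounded_integrable_itvoc _ _ _ _ `|c|).
rewrite -hE [_ * `|_|]mulrC [_ * (2 * om)]mulrC -!Rintegral_cst// -RintegralD//; last exact: ci.
apply: le_Rintegral => //.
- exact: ci.
- exact: (integrable_plus (measurable_itv _) dixy (ci _)).
move=> t; rewrite /= in_itv/= => /andP[xt ty].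
have := Hd y t; rewrite ay yb (le_trans ax (ltW xt)) (le_trans ty yb) => /(_ isT isT).
rewrite (grid_unif N0 hd (i := i)) -/x -/y ?lexx ?xy ?(ltW xt) ?ty// => /(_ isT) H1.
have := Hd' y t; rewrite ay yb (le_trans ax (ltW xt)) (le_trans ty yb) => /(_ isT isT).
rewrite (grid_unif N0 hd' (i := i)) -/x -/y ?lexx ?xy ?(ltW xt) ?ty// => /(_ isT) H2.
have -> : u y - v y = (u y - u t) + (u t - v t) - (v y - v t) by ring.
apply: le_trans (ler_normB _ _) _; apply: le_trans (lerD (ler_normD _ _) (lexx _)) _.
lra.
Qed.

Lemma abel_sum (th ga : nat -> R) N :
  \sum_(i < N) (th i.+1 - th i) * ga i + \sum_(i < N) th i.+1 * (ga i.+1 - ga i) =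
  th N * ga N - th 0%N * ga 0%N.
Proof.
elim: N => [|N IH]; first by rewrite !big_ord0 subrr addr0.
rewrite !big_ord_recr/=.
have -> : forall p q r s : R, p + q + (r + s) = (p + r) + (q + s) by move=> *; ring.
by rewrite IH; ring.
Qed.

(** At a level [|t| <= T] the two integrands differ by at most [e] plus [C * h] for every [i] with
    [th i.+1 t] nonzero; beyond [T] both vanish. Integration over [[-T, T]] turns [e] into
    [2 * T * e], and [|th i.+1 t|] integrates to [|u - v|] at the right end of cell [i]. *)
Lemma riemann_pairing_dist (u v : R -> R) N (e C : R) : (0 < N)%N -> 0 <= e -> 0 <= C ->
  let h := (b - a) / N%:R in
  (forall (t : R) (P : pred nat),
    \sum_(i < N | P i) `|g (grid a h i.+1) t - g (grid a h i) t| <=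
    e + \sum_(i < N | P i) C * h) ->
  `|riemann_pairing u N - riemann_pairing v N| <=
  2 * T * e + C * \sum_(i < N) h * `|u (grid a h i.+1) - v (grid a h i.+1)|.
Proof.
move=> N0 e0 C0 h var; have h0 : 0 <= h by exact/ltW/step_gt0.
have xin i : (i <= N)%N -> a <= grid a h i <= b by move=> iN; exact: grid_in.
pose th i t := below (u (grid a h i)) t - below (v (grid a h i)) t.
pose F (f : R -> R) i t :=
  (below (f (grid a h i.+1)) t - below (f (grid a h i)) t) * g (grid a h i) t.
have Fi f i : (i < N)%N -> mu.-integrable setT (EFin \o F f i).
  by move=> iN; apply: below_slice_integrable; apply: xin; exact: ltnW.
have [SF1 SF2] := Rintegral_sum_ord measurableT (fun i iN => Fi u i iN).
have [SG1 SG2] := Rintegral_sum_ord measurableT (fun i iN => Fi v i iN).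
rewrite /riemann_pairing -/h -SF2 -SG2 -RintegralB//.
pose K i t := C * h * `|th i.+1 t|.
have Ki i : (i < N)%N -> mu.-integrable setT (EFin \o K i).
  move=> _; apply: integrable_scale => //.
  by have [] := below_integral_norm (u (grid a h i.+1)) (v (grid a h i.+1)).
have [SK1 SK2] := Rintegral_sum_ord measurableT Ki.
have Ti : mu.-integrable setT (EFin \o (fun t => e * \1_(`[- T, T]%classic) t)).
  by apply: integrable_scale => //; exact: integrable_indic_itv.
have -> : 2 * T * e + C * \sum_(i < N) h * `|u (grid a h i.+1) - v (grid a h i.+1)| =
   \int[mu]_t (e * \1_(`[- T, T]%classic) t + \sum_(i < N) K i t).
  rewrite RintegralD// SK2; congr (_ + _).
    rewrite RintegralZl//; last exact: integrable_indic_itv.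
    rewrite /Rintegral integral_indic// setIT.
    have -> : 2 * T * e = e * (T - - T) by ring.
    congr (_ * _); transitivity (fine (mu `[- T, T])) => //.
    rewrite lebesgue_measure_itv/= lte_fin.
    by case: ltP => //= ?; have := T0; lra.
  rewrite mulr_sumr; apply: eq_bigr => i _.
  have [I1 I2] := below_integral_norm (u (grid a h i.+1)) (v (grid a h i.+1)).
  by rewrite /K RintegralZl// I2 mulrA.
apply: Rintegral_abs_le => //.
- exact: (integrable_minus measurableT SF1 SG1).
- exact: (integrable_plus measurableT Ti SK1).
move=> t _.
(* [abel_sum] moves the differences from the indicators to [g]; the boundary terms drop out because
   [g a] and [g b] vanish. *)
have -> : \sum_(i < N) F u i t - \sum_(i < N) F v i t =
    - \sum_(i < N) th i.+1 t * (g (grid a h i.+1) t - g (grid a h i) t).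
  have := abel_sum (th^~ t) (fun i => g (grid a h i) t) N.
  rewrite grid0 g_a grid_end// g_b !mulr0 subrr => /eqP.
  rewrite addr_eq0 => /eqP <-; rewrite -sumrB; apply: eq_bigr => i _.
  by rewrite /F /th; ring.
rewrite normrN; apply: le_trans (ler_norm_sum _ _ _) _.
have [tT|Tt] := leP `|t| T; last first.
  rewrite big1 ?addr_ge0 ?mulr_ge0 ?indicE ?ler0n ?sumr_ge0//.
    by move=> i _; apply: mulr_ge0 => //; exact: mulr_ge0.
  by move=> i _; rewrite !g_supp ?subrr ?mulr0 ?normr0 ?xin// ltnW.
rewrite indicE mem_set ?mulr1/=; last by rewrite in_itv/= -ler_norml.
(* The values of [th] are [-1], [0] and [1], so its absolute value is itself the indicator of a
   selection of cells. *)
have th01 i : `|th i t| = (th i t != 0)%:R.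
  rewrite /th /below; case: (_ < _); case: (_ < _); rewrite ?subrr ?eqxx ?normr0//=.
    by rewrite subr0 oner_eq0 normr1.
  by rewrite sub0r oppr_eq0 oner_eq0 normrN1.
apply: le_trans (le_trans (var t (fun i => th i.+1 t != 0)) _); last first.
  rewrite lerD2l big_mkcond/=; apply: ler_sum => i _; rewrite /K th01.
  by case: ifP => _; rewrite ?mulr1 ?mulr0.
rewrite [leRHS]big_mkcond/=; apply: ler_sum => i _; rewrite normrM th01.
by case: ifP => _; rewrite ?mul1r ?mul0r.
Qed.

(** [C] is fixed by the variation of [g] before the two functions appear. The mesh is chosen
    afterwards and depends on them; its error [eta] is arbitrary and disappears. *)
Lemma pairing_continuity : forall e : R, 0 < e -> exists2 C : R, 0 <= C &
  forall u w v z, primitive_on a b u w -> primitive_on a b v z ->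
  `|\int[mu]_(x in `]a, b]) (g x (u x) * w x) -
    \int[mu]_(x in `]a, b]) (g x (v x) * z x)| <=
  e + C * \int[mu]_(x in `]a, b]) `|u x - v x|.
Proof.
move=> e e0; pose e1 := e / (2 * T + 1).
have e10 : 0 < e1 by rewrite divr_gt0//; have := T0; lra.
have Te1 : 2 * T * e1 <= e.
  have -> : 2 * T * e1 = e * ((2 * T) / (2 * T + 1)) by rewrite /e1; ring.
  by rewrite -[leRHS]mulr1 ler_wpM2l ?(ltW e0)// ler_pdivrMr; have := T0; lra.
have [C [h0 [C0 h00 Hvar]]] := g_var e10.
exists C => // u w v z uw vz; apply/ler_addgt0Pr => eta eta0.
(* Two pairings are approximated within [et], and so is the sampled distance, which is then
   multiplied by [C]. *)
pose et := eta / (2 + C).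
have C2 : 0 < 2 + C by lra.
have et0 : 0 < et by rewrite divr_gt0.
have [hu hu0 Hu] := riemann_pairing_cvg uw et0.
have [hv hv0 Hv] := riemann_pairing_cvg vz et0.
have [hd hd0 Hd] := riemann_sum_dist uw vz et0.
pose hm := Num.min (Num.min hu hv) (Num.min hd h0).
have hm0 : 0 < hm by rewrite !lt_min hu0 hv0 hd0.
pose N := (Num.truncn ((b - a) / hm)).+1.
have hN : (b - a) / N%:R < hm.
  rewrite ltr_pdivrMr ?ltr0n// mulrC -ltr_pdivrMr// /N.
  exact: truncnS_gt.
move: hN; rewrite !lt_min => /andP[/andP[hNu hNv] /andP[hNd hN0]].
have N0 : (0 < N)%N by [].
have H1 := Hu N N0 hNu; have H2 := Hv N N0 hNv; have H3 := Hd N N0 hNd.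
have H4 := riemann_pairing_dist u v N0 (ltW e10) C0 (Hvar N N0 hN0).
set Iu := \int[mu]_(x in _) (g x (u x) * w x) in H1 *.
set Iv := \int[mu]_(x in _) (g x (v x) * z x) in H2 *.
have -> : Iu - Iv = (riemann_pairing u N - riemann_pairing v N) -
  (riemann_pairing u N - Iu) + (riemann_pairing v N - Iv) by ring.
apply: le_trans (ler_normD _ _) _; apply: le_trans (lerD (ler_normB _ _) (lexx _)) _.
apply: le_trans (lerD (lerD H4 H1) H2) _.
have etE : (2 + C) * et = eta by rewrite /et mulrC divfK// gt_eqF.
have := ler_wpM2l C0 H3; rewrite -etE.
set S := \sum_(i < N) _; rewrite mulrDr mulrDl; lra.
Qed.

End stieltjes_pairing.

(** * Uniform continuity and cutoffs *)

Section uniform_continuity.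
Context {R : realType}.

(** Continuity at the points of [K] is meant in the ambient space, so only [p] is confined to [K]
    and [q] may leave it. Compactness is applied to balls of half the radius of continuity. *)
Lemma compact_unif_continuous (T : pseudoMetricType R) (F : T -> R) (K : set T) :
  compact K -> (forall p, K p -> {for p, continuous F}) ->
  forall e : R, 0 < e -> exists2 d : R, 0 < d &
    forall p q, K p -> ball p d q -> `|F p - F q| < e.
Proof.
move=> /compact_near_coveringP cK cF e e0.
have := cK R ((0:R)^'+) (fun d p => forall q, ball p d q -> `|F p - F q| < e) _.
case=> [p Kp|d /= d0 Hd].
  have e20 : 0 < e / 2 by rewrite divr_gt0.
  have /cvgrPdist_lt/(_ _ e20)/nbhs_ballP[r r0 Hr] := cF p Kp.
  have r20 : 0 < r / 2 by rewrite divr_gt0.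
  exists (ball p (r / 2), [set d | 0 < d < r / 2]).
    split; first exact: nbhsx_ballx.
    near=> d => /=; apply/andP; split; first by near: d; exact: nbhs_right_gt.
    by near: d; exact: nbhs_right_lt.
  move=> [p' d] /= [pp' /andP[d0 dr]] q p'q.
  have H1 : `|F p - F p'| < e / 2.
    by apply: Hr; apply: le_ball pp'; lra.
  have H2 : `|F p - F q| < e / 2.
    apply: Hr; rewrite [r]splitr; apply: ball_triangle pp' _.
    by apply: le_ball p'q; exact: ltW.
  have -> : F p' - F q = (F p - F q) - (F p - F p') by ring.
  by apply: le_lt_trans (ler_normB _ _) _; lra.
exists (d / 2) => /=; first by rewrite divr_gt0.
move=> p q Kp pq; apply: (Hd (d / 2)) => //=.
  by rewrite sub0r normrN gtr0_norm ?divr_gt0//; lra.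
by rewrite divr_gt0.
Unshelve. all: by end_near. Qed.

Lemma compact_continuous_bounded (T : topologicalType) (F : T -> R) (K : set T) :
  compact K -> (forall p, K p -> {for p, continuous F}) ->
  exists B : R, forall p, K p -> `|F p| <= B.
Proof.
move=> cK cF; have [->|/set0P K0] := eqVneq K set0; first by exists 0.
have cW : {within K, continuous F}.
  by apply/subspace_continuousP => p Kp; apply: cvg_within_filter; exact: cF.
have [cM _ HM] := compact_EVT_max K0 cK cW.
have [cm _ Hm] := compact_EVT_min K0 cK cW.
exists (`|F cM| + `|F cm|) => p Kp.
have := HM p (mem_set Kp); have := Hm p (mem_set Kp).
have := ler_norm (F cM); have := ler_norm (- F cm); rewrite normrN.
by rewrite ler_norml => *; have := normr_ge0 (F cM); have := normr_ge0 (F cm); lra.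
Qed.

End uniform_continuity.

(** * Lipschitz cutoffs in the variable and in the value *)

Section cutoffs.
Context {R : realType}.
Implicit Types (a b k M x y s t : R).

Lemma minr_dist (p q p' q' r : R) : `|p - p'| <= r -> `|q - q'| <= r ->
  `|Num.min p q - Num.min p' q'| <= r.
Proof.
rewrite !ler_norml => /andP[? ?] /andP[? ?].
by case: (leP p q) => ?; case: (leP p' q') => ?; lra.
Qed.

Lemma maxr_dist (p q p' q' r : R) : `|p - p'| <= r -> `|q - q'| <= r ->
  `|Num.max p q - Num.max p' q'| <= r.
Proof.
rewrite !ler_norml => /andP[? ?] /andP[? ?].
by case: (leP p q) => ?; case: (leP p' q') => ?; lra.
Qed.

(** A trapezoid over [[a, b]] with sides of slopes [k] and [-k], or a triangle if [k] is small. A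
    steep cutoff loses little of the energy; its Lipschitz constant [k] enters the variation bound
    instead. *)
Definition edge_cutoff a b k x : R := Num.min 1 (Num.min (k * (x - a)) (k * (b - x))).

Lemma edge_cutoff01 a b k x : 0 <= k -> a <= x <= b -> 0 <= edge_cutoff a b k x <= 1.
Proof.
move=> k0 /andP[ax xb]; rewrite /edge_cutoff ge_min lexx !le_min ler01/=.
by rewrite !mulr_ge0// subr_ge0.
Qed.

Lemma edge_cutoff_l a b k : 0 <= k -> a <= b -> edge_cutoff a b k a = 0.
Proof.
move=> k0 ab; rewrite /edge_cutoff subrr mulr0.
have kab : 0 <= k * (b - a) by rewrite mulr_ge0// subr_ge0.
by rewrite (min_idPl kab) (min_idPr ler01).
Qed.

Lemma edge_cutoff_r a b k : 0 <= k -> a <= b -> edge_cutoff a b k b = 0.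
Proof.
move=> k0 ab; rewrite /edge_cutoff subrr mulr0.
have kab : 0 <= k * (b - a) by rewrite mulr_ge0// subr_ge0.
by rewrite (min_idPr kab) (min_idPr ler01).
Qed.

Lemma edge_cutoff1 a b k x : 1 <= k * (x - a) -> 1 <= k * (b - x) -> edge_cutoff a b k x = 1.
Proof. by move=> h1 h2; rewrite /edge_cutoff; apply/min_idPl; rewrite le_min h1. Qed.

Lemma edge_cutoff_lip a b k x y : 0 <= k ->
  `|edge_cutoff a b k x - edge_cutoff a b k y| <= k * `|x - y|.
Proof.
move=> k0; apply: minr_dist; first by rewrite subrr normr0 mulr_ge0.
apply: minr_dist; rewrite -mulrBr normrM (ger0_norm k0) ler_wpM2l//.
  by rewrite [X in `|X|](_ : _ = x - y)//; ring.
by rewrite distrC [X in `|X|](_ : _ = x - y)//; ring.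
Qed.

Definition plateau M s : R := Num.min 1 (Num.max 0 (M + 1 - `|s|)).

Lemma plateau01 M s : 0 <= plateau M s <= 1.
Proof. by rewrite /plateau ge_min lexx le_min ler01 le_max lexx. Qed.

Lemma plateau1 M s : `|s| <= M -> plateau M s = 1.
Proof. by move=> sM; apply/min_idPl; rewrite le_max; apply/orP; right; lra. Qed.

Lemma plateau0 M s : M + 1 < `|s| -> plateau M s = 0.
Proof.
move=> sM; rewrite /plateau (max_idPl _) ?(min_idPr ler01)//; lra.
Qed.

Lemma plateau_lip M s t : `|plateau M s - plateau M t| <= `|s - t|.
Proof.
apply: minr_dist; first by rewrite subrr normr0.
apply: maxr_dist; first by rewrite subrr normr0.
rewrite [X in `|X|](_ : _ = - (`|s| - `|t|)); last by ring.
by rewrite normrN; exact: ler_dist_dist.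
Qed.

Lemma lip_continuous (F : R -> R) k x : (forall y, `|F x - F y| <= k * `|x - y|) ->
  {for x, continuous F}.
Proof.
move=> H; apply/cvgrPdist_lt => e e0.
have k1 : 0 < `|k| + 1 by rewrite ltr_pwDr.
apply/nbhs_ballP; exists (e / (`|k| + 1)) => /=; first by rewrite divr_gt0.
move=> y /=; rewrite ltr_pdivlMr// => xy; apply: le_lt_trans (H y) _.
apply: le_lt_trans xy; rewrite mulrC ler_wpM2l//.
by apply: le_trans (ler_norm _) _; rewrite lerDl.
Qed.

Lemma cutoff_unif a b k M (F : R -> R -> R) : 0 <= k ->
  (forall x s, a <= x <= b -> {for (x, s), continuous (fun p : R * R => F p.1 p.2)}) ->
  forall e : R, 0 < e -> exists2 d : R, 0 < d &
  forall x y s t, a <= x <= b -> a <= y <= b -> `|x - y| < d -> `|s - t| < d ->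
    `|edge_cutoff a b k x * plateau M s * F x s -
      edge_cutoff a b k y * plateau M t * F y t| < e.
Proof.
move=> k0 cF e e0.
pose G (p : R * R) := edge_cutoff a b k p.1 * plateau M p.2 * F p.1 p.2.
(* One unit wider than the support of the plateau: if [|s| > M + 2] and [|s - t| < 1], both products
   vanish. *)
have cK : compact (`[a, b] `*` `[- (M + 2), M + 2] : set (R * R)).
  by apply: compact_setX; exact: segment_compact.
have cG p : (`[a, b] `*` `[- (M + 2), M + 2]) p -> {for p, continuous G}.
  case: p => x s [/= + _]; rewrite in_itv/= => xab.
  apply: cvgM; last exact: cF.
  apply: cvgM.
    apply: (@cvg_comp _ _ _ fst (edge_cutoff a b k) (nbhs (x, s)) (nbhs x)); first exact: cvg_fst.
    by apply: (@lip_continuous _ k) => y; exact: edge_cutoff_lip.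
  apply: (@cvg_comp _ _ _ snd (plateau M) (nbhs (x, s)) (nbhs s)); first exact: cvg_snd.
  by apply: (@lip_continuous _ 1) => y; rewrite mul1r; exact: plateau_lip.
have [d d0 Hd] := compact_unif_continuous cK cG e0.
exists (Num.min d 1); first by rewrite lt_min d0 ltr01.
move=> x y s t xab yab; rewrite !lt_min => /andP[xy _] /andP[st st1].
have [sM|Ms] := leP `|s| (M + 2).
  apply: (Hd (x, s) (y, t)); last by split.
  by split => /=; rewrite in_itv//= -ler_norml.
rewrite !plateau0 ?mulr0 ?mul0r ?subrr ?normr0//; last by lra.
have := ler_normD (s - t) t; rewrite subrK; lra.
Qed.

End cutoffs.

(** * Variation bounds and measurability *)

Section block_sums.
Context {R : realType}.

(* Splitting an index list into blocks of total length between [d / 4] and [d]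
   turns smallness on short families into an affine bound on arbitrary ones. *)
Lemma sum_le_blocks (c : nat -> R) (e d h : R) (Q : seq nat -> Prop) :
  0 < h -> 0 < d -> h <= d / 2 -> 0 <= e ->
  (forall s q, Q s -> Q (take q s) /\ Q (drop q s)) ->
  (forall s, Q s -> h * (size s)%:R < d -> \sum_(i <- s) c i <= e) ->
  forall s, Q s -> \sum_(i <- s) c i <= e + \sum_(i <- s) (4 * e / d * h).
Proof.
move=> h0 d0 hd e0 Qs Hs s.
have [n] := ubnP (size s); elim: n s => // n IH s sn Qss.
have [sd|ds] := ltP (h * (size s)%:R) d.
  apply: le_trans (Hs s Qss sd) _; rewrite lerDl sumr_ge0// => i _.
  by rewrite mulr_ge0 ?(ltW h0)// divr_ge0 ?(ltW d0)// mulr_ge0.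
(* As [h <= d / 2], this puts [h * q] between [d / 4] and [3 / 4 * d]: the block is short enough for
   the hypothesis on short families, and long enough that [4 * e / d] times its length is at least
   [e]. *)
pose q := Num.truncn (3 / 4 * d / h).
have x0 : 0 <= 3 / 4 * d / h by rewrite divr_ge0 ?(ltW h0)//; lra.
have /andP[q1 q2] := truncn_itv x0.
have {}q1 : h * q%:R <= 3 / 4 * d by rewrite mulrC -ler_pdivlMr.
have {}q2 : 3 / 4 * d < h * q%:R + h.
  have : 3 / 4 * d / h < q%:R + 1 by rewrite natr1.
  by rewrite ltr_pdivrMr//; lra.
have qs : (q <= size s)%N.
  rewrite -(@ler_nat R) -(ler_pM2l h0); lra.
have q0 : (0 < q)%N.
  rewrite lt0n; apply/eqP => q00; rewrite q00 mulr0 in q2; lra.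
have [Q1 Q2] := Qs s q Qss.
rewrite -(cat_take_drop q s) !big_cat/=.
have H1 : \sum_(i <- take q s) c i <= e.
  apply: (Hs (take q s) Q1); rewrite size_takel//.
  by apply: le_lt_trans q1 _; lra.
have H2 : \sum_(i <- drop q s) c i <= e + \sum_(i <- drop q s) (4 * e / d * h).
  apply: IH => //; rewrite size_drop; apply: (@leq_trans (size s)); last by rewrite -ltnS.
  by rewrite ltn_subrL q0 (leq_trans q0 qs).
have H3 : e <= \sum_(i <- take q s) (4 * e / d * h).
  rewrite big_const_seq count_predT size_takel// iter_addr_0 -[_ *+ q]mulr_natr.
  have -> : 4 * e / d * h * q%:R = e * (4 * (h * q%:R) / d) by ring.
  rewrite -[leLHS]mulr1 ler_wpM2l// ler_pdivlMr//; lra.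
lra.
Qed.

(** Selected cells are a list of distinct indices, hence disjoint intervals, and so are its prefixes
    and suffixes. Cutting it into blocks shorter than the [d] of absolute continuity yields
    [C = 4 * e / d]; the mesh bound [d / 2] keeps one cell from filling a block. *)
Lemma grid_variation (a b : R) (F : R -> R -> R) (H : set R) : a < b ->
  (forall eps : R, 0 < eps -> exists2 delta : R, 0 < delta &
     forall s, H s -> forall (N : nat) (x y : nat -> R),
       (forall i, (i < N)%N -> x i < y i /\ `]x i, y i[ `<=` `[a, b]) ->
       (forall i j, (i < N)%N -> (j < N)%N -> i <> j ->
          `]x i, y i[ `&` `]x j, y j[ = set0) ->
       \sum_(i < N) (y i - x i) < delta ->
       \sum_(i < N) `|F (y i) s - F (x i) s| < eps) ->
  forall e : R, 0 < e -> exists C h0 : R, [/\ 0 <= C, 0 < h0 &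
    forall N, (0 < N)%N -> let h := (b - a) / N%:R in h < h0 ->
    forall (t : R) (P : pred nat), H t ->
    \sum_(i < N | P i) `|F (grid a h i.+1) t - F (grid a h i) t| <=
    e + \sum_(i < N | P i) C * h].
Proof.
move=> ab AC e e0; have [d d0 Hd] := AC e e0.
exists (4 * e / d), (d / 2); split.
- by rewrite divr_ge0 ?(ltW d0)// mulr_ge0// ltW.
- by rewrite divr_gt0.
move=> N N0 h hd t P Ht.
have h0 : 0 < h by rewrite divr_gt0 ?subr_gt0 ?ltr0n.
have E (G : nat -> R) : \sum_(i < N | P i) G i =
    \sum_(i <- [seq i <- index_iota 0 N | P i]) G i by rewrite big_filter big_mkord.
rewrite (E (fun i => `|F (grid a h i.+1) t - F (grid a h i) t|)).
rewrite (E (fun=> 4 * e / d * h)).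
pose Q s := uniq s /\ all (fun i => i < N)%N s.
apply: (sum_le_blocks (Q := Q) h0 d0 (ltW hd) (ltW e0)).
- move=> s q [us /allP sN]; split; split.
  + exact: take_uniq.
  + by apply/allP => i /mem_take; exact: sN.
  + exact: drop_uniq.
  + by apply/allP => i /mem_drop; exact: sN.
- move=> s [us /allP sN] sd; rewrite (big_nth 0%N) big_mkord; apply/ltW.
  have nN i : (i < size s)%N -> (nth 0%N s i < N)%N by move=> /(mem_nth 0%N); exact: sN.
  apply: (Hd t Ht (size s) (fun i => grid a h (nth 0%N s i)) (fun i => grid a h (nth 0%N s i).+1)).
  + move=> i /nN iN; split; first by rewrite gridS ltrDl.
    move=> x; rewrite /= !in_itv/= => /andP[x1 x2].
    have := grid_le a (ltW h0) (leq0n (nth 0%N s i)); rewrite grid0 => ax.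
    have := grid_le a (ltW h0) iN; rewrite grid_end// => xb.
    by rewrite (le_trans ax (ltW x1)) (le_trans (ltW x2) xb).
  + move=> i j iN jN ij; apply/seteqP; split => // x /= [].
    rewrite !in_itv/= => /andP[x1 x2] /andP[x3 x4].
    have nij : nth 0%N s i <> nth 0%N s j.
      by move=> /eqP; rewrite nth_uniq// => /eqP.
    have [lt|lt|//] := ltngtP (nth 0%N s i) (nth 0%N s j).
      by have := grid_le a (ltW h0) lt; lra.
    by have := grid_le a (ltW h0) lt; lra.
  + rewrite (eq_bigr (fun=> h)); last by move=> i _; rewrite gridS; ring.
    by rewrite sumr_const card_ord -[_ *+ size s]mulr_natr.
split; first by rewrite filter_uniq// iota_uniq.
apply/allP => i; rewrite mem_filter mem_iota => /andP[_ /andP[_]].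
by rewrite add0n subn0.
Qed.

End block_sums.

(** * Measurability of compositions with a continuous integrand *)

Section measurability.
Context {R : realType}.
Local Notation mu := (@lebesgue_measure R).

Lemma rational_window (x r c s : R) : x - r / 3 < c < x + r / 3 -> r / 3 < s < r / 2 ->
  c - s < x < c + s /\ forall y, c - s < y < c + s -> `|x - y| < r.
Proof.
move=> /andP[c1 c2] /andP[s1 s2]; split=> [|y /andP[y1 y2]].
  by apply/andP; split; lra.
by rewrite ltr_norml; apply/andP; split; lra.
Qed.

(** [O] is the union of the countably many cubes with rational centre and half-side that it
    contains, and the preimage of a cube is an intersection of three measurable preimages. *)
Lemma open_triple_measurable (D : set (measurableTypeR R)) (u v w : R -> R)
    (O : set (R * R * R)) : measurable D -> open O ->
  measurable_fun D u -> measurable_fun D v -> measurable_fun D w ->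
  measurable (D `&` [set x | O (u x, v x, w x)]).
Proof.
move=> mD oO mu_ mv mw.
pose box (q : rat * rat * rat * rat) : set R :=
  [set x | D x /\ [/\ `]ratr q.1.1.1 - ratr q.2, ratr q.1.1.1 + ratr q.2[%classic (u x),
   `]ratr q.1.1.2 - ratr q.2, ratr q.1.1.2 + ratr q.2[%classic (v x) &
   `]ratr q.1.2 - ratr q.2, ratr q.1.2 + ratr q.2[%classic (w x)]].
pose good (q : rat * rat * rat * rat) := forall p : R * R * R,
  `]ratr q.1.1.1 - ratr q.2, ratr q.1.1.1 + ratr q.2[%classic p.1.1 ->
  `]ratr q.1.1.2 - ratr q.2, ratr q.1.1.2 + ratr q.2[%classic p.1.2 ->
  `]ratr q.1.2 - ratr q.2, ratr q.1.2 + ratr q.2[%classic p.2 -> O p.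
have -> : D `&` [set x | O (u x, v x, w x)] =
    \bigcup_q [set x | good q /\ box q x].
  apply/seteqP; split => [x [Dx Ox]|x [q _ /= [gq [Dx [b1 b2 b3]]]]]; last first.
    split => //.
    exact: (gq (u x, v x, w x)).
  have /nbhs_ballP[r r0 Hr] := (oO _ Ox : nbhs (u x, v x, w x) O).
  have r3 : 0 < r / 3 by rewrite divr_gt0.
  have rr : r / 3 < r / 2 by lra.
  have [s sr] : exists s : rat, r / 3 < ratr s < r / 2.
    by have [s] := rat_in_itvoo rr; exists s; rewrite in_itv/= in p.
  have near (y : R) : exists c : rat, y - r / 3 < ratr c < y + r / 3.
    have yy : y - r / 3 < y + r / 3 by lra.
    by have [c] := rat_in_itvoo yy; exists c; rewrite in_itv/= in p.
  have [[c1 c1x] [c2 c2x] [c3 c3x]] := And3 (near (u x)) (near (v x)) (near (w x)).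
  have [b1 d1] := rational_window c1x sr; have [b2 d2] := rational_window c2x sr.
  have [b3 d3] := rational_window c3x sr.
  exists (c1, c2, c3, s) => //=; split; last by split; rewrite // !in_itv/=.
  move=> [[p1 p2] p3]/=; rewrite !in_itv/= => /d1 ? /d2 ? /d3 ?.
  by apply: Hr; split.
apply: countable_bigcupT_measurable => [|q]; first exact: countableP.
have [gq|gq] := pselect (good q); last first.
  by rewrite (_ : [set x | _] = set0)//; apply/seteqP; split => // x [].
rewrite (_ : [set x | _] = box q); last by apply/seteqP; split => [x []|x].
have mi (f : R -> R) (c s : rat) : measurable_fun D f ->
    measurable (D `&` f @^-1` `]ratr c - ratr s, ratr c + ratr s[%classic).
  by move=> mf; exact: (mf mD _ (measurable_itv _)).
have -> : box q = (D `&` u @^-1` `]ratr q.1.1.1 - ratr q.2, ratr q.1.1.1 + ratr q.2[%classic) `&`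
  (D `&` v @^-1` `]ratr q.1.1.2 - ratr q.2, ratr q.1.1.2 + ratr q.2[%classic) `&`
  (D `&` w @^-1` `]ratr q.1.2 - ratr q.2, ratr q.1.2 + ratr q.2[%classic).
  by apply/seteqP; split => [x [Dx []]//|x [[[Dx b1] [_ b2]] [_ b3]]]; split.
by apply: measurableI; [apply: measurableI|]; exact: mi.
Qed.

(** Superlevel sets of [F] are intersected with the fibres over [A], where [F] is known to be
    continuous; since [A] is open, the result is open. *)
Lemma continuous_triple_measurable (D : set (measurableTypeR R)) (A : set R)
    (u w : R -> R) (F : R -> R -> R -> R) : measurable D -> open A -> D `<=` A ->
  (forall p : R * R * R, A p.1.1 -> {for p, continuous (fun p => F p.1.1 p.1.2 p.2)}) ->
  measurable_fun D u -> measurable_fun D w ->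
  measurable_fun D (fun x => F x (u x) (w x)).
Proof.
move=> mD oA DA cF mu_ mw.
apply: (measurability _ (RGenOInfty.measurableE R)) => //.
move=> _ [_ [y ->] <-].
pose O := [set p : R * R * R | A p.1.1 /\ y < F p.1.1 p.1.2 p.2].
have oO : open O.
  rewrite openE => p [Ap yF].
  have n1 : nbhs p [set q : R * R * R | A q.1.1].
    have c1 : (fun q : R * R * R => q.1.1) @ p --> p.1.1.
      by apply: (@cvg_comp _ _ _ fst fst _ (nbhs p.1)); exact: cvg_fst.
    by apply: c1; exact: open_nbhs_nbhs.
  have n2 : nbhs p [set q : R * R * R | y < F q.1.1 q.1.2 q.2].
    by have := cF p Ap; move=> /cvgr_gt; exact.
  by rewrite /interior; apply: filterS2 n1 n2 => q.
have := open_triple_measurable mD oO (@measurable_id _ _ D) mu_ mw.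
congr measurable; apply/seteqP; split => [x [Dx [_ Hx]]|x [Dx Hx]].
  by split => //=; rewrite in_itv/= andbT.
by split => //=; split; [exact: DA|move: Hx; rewrite /= in_itv/= andbT].
Qed.

End measurability.

(** * Lower bound on a compact interval *)

Section convex_integrand.
Context {R : realType} (Omega : set R) (f : R -> R -> R -> R).
Local Notation mu := (@lebesgue_measure R).
Hypothesis hOmega : open Omega.
Hypothesis hpos : forall x s xi, Omega x -> 0 <= f x s xi.
Hypothesis hcont : {within [set p : R * R * R | Omega p.1.1],
  continuous (fun p : R * R * R => f p.1.1 p.1.2 p.2)}.
Hypothesis hconv : forall x s, Omega x -> forall (t a b : R), 0 <= t -> t <= 1 ->
  f x s (t * a + (1 - t) * b) <= t * f x s a + (1 - t) * f x s b.
Hypothesis hder : forall x s xi, Omega x -> derivable (f x s) xi 1.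
Hypothesis hdercont : {within [set p : R * R * R | Omega p.1.1],
  continuous (fun p : R * R * R => fxi f p.1.1 p.1.2 p.2)}.
Hypothesis hLip : forall K1 : set (R * R), compact K1 -> K1 `<=` [set p | Omega p.1] ->
  exists L1 : R,
    (forall x s xi, K1 (x, s) -> `|fxi f x s xi| <= L1) /\
    (forall x s xi1 xi2, K1 (x, s) ->
       `|fxi f x s xi1 - fxi f x s xi2| <= L1 * `|xi1 - xi2|).

Lemma within_fiber_continuous (F : R -> R -> R -> R) :
  {within [set p : R * R * R | Omega p.1.1],
    continuous (fun p : R * R * R => F p.1.1 p.1.2 p.2)} ->
  forall p : R * R * R, Omega p.1.1 ->
  {for p, continuous (fun p : R * R * R => F p.1.1 p.1.2 p.2)}.
Proof.
have oS : open [set p : R * R * R | Omega p.1.1].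
  have cp : continuous (fun p : R * R * R => p.1.1).
    by move=> p; apply: (@cvg_comp _ _ _ fst fst _ (nbhs p.1)); exact: cvg_fst.
  by apply: (@open_comp _ _ (fun p : R * R * R => p.1.1)) => // p _; exact: cp.
rewrite continuous_open_subspace// => H p Op.
exact: (H p (mem_set Op)).
Qed.

Lemma slice_continuous (F : R -> R -> R -> R) xi :
  {within [set p : R * R * R | Omega p.1.1],
    continuous (fun p : R * R * R => F p.1.1 p.1.2 p.2)} ->
  forall x s, Omega x -> {for (x, s), continuous (fun p : R * R => F p.1 p.2 xi)}.
Proof.
move=> /within_fiber_continuous H x s Ox.
have c : (fun p : R * R => (p, xi)) @ (x, s) --> ((x, s), xi).
  exact: (@cvg_pair _ _ _ _ _ (nbhs xi) _ _ _ id (fun=> xi) (@cvg_id _ _) (cvg_cst xi)).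
exact: (@cvg_comp _ _ _ (fun p : R * R => (p, xi))
  (fun p : R * R * R => F p.1.1 p.1.2 p.2) _ _ _ c (H ((x, s), xi) Ox)).
Qed.

(** If the value at [eta] were below the tangent, the quotients along [v = eta - xi], which tend to
    [v * fxi f x s xi], would exceed [f x s eta - f x s xi] at small multiples [t * v], against
    convexity on the segment from [xi] to [eta]. *)
Lemma tangent_le x s xi eta : Omega x ->
  f x s xi + fxi f x s xi * (eta - xi) <= f x s eta.
Proof.
move=> Ox; rewrite leNgt; apply/negP => lt.
set v := eta - xi in lt.
have v0 : v != 0.
  apply/eqP => v0; move: lt; rewrite v0 mulr0 addr0.
  have -> : xi = eta by move: v0; rewrite /v; lra.
  by rewrite ltxx.
have cD : (fun h : R => h^-1 *: (f x s (h + xi) - f x s xi)) @ 0^' --> fxi f x s xi.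
  have := @hder x s xi Ox; rewrite /derivable.
  have -> : (fun h : R => h^-1 *: ((f x s \o shift xi) (h *: 1) - f x s xi)) =
     (fun h : R => h^-1 *: (f x s (h + xi) - f x s xi)).
    by apply/funext => h /=; rewrite scaler1.
  by move=> /cvg_ex [l hl]; rewrite /fxi /derive1 (cvg_lim _ hl).
have cvD : (fun h : R => v * (h^-1 *: (f x s (h + xi) - f x s xi))) @ 0^' --> v * fxi f x s xi.
  by apply: cvgM => //; exact: cvg_cst.
have lt' : f x s eta - f x s xi < v * fxi f x s xi by rewrite mulrC; lra.
have := cvgr_gt _ cvD _ lt'.
case=> r /= r0 Hr.
have nv0 : 0 < `|v| by rewrite normr_gt0.
(* [t <= 1] serves convexity, and [t * |v| < r] the neighbourhood in which the quotient is
   controlled. *)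
pose t := Num.min 1 (r / (2 * `|v|)).
have t0 : 0 < t by rewrite lt_min ltr01 divr_gt0// mulr_gt0.
have t1 : t <= 1 by rewrite ge_min lexx.
have tr : t * `|v| < r.
  apply: (@le_lt_trans _ _ (r / 2)); last by lra.
  rewrite -ler_pdivlMr//; rewrite ge_min; apply/orP; right.
  by rewrite invfM mulrA.
have := Hr (t * v); rewrite /= sub0r normrN normrM (gtr0_norm t0) => /(_ tr).
have tv0 : t * v != 0 by rewrite mulf_neq0// gt_eqF.
move=> /(_ tv0).
rewrite /GRing.scale/= ltNge => /negP; apply.
have -> : v * ((t * v)^-1 * (f x s (t * v + xi) - f x s xi)) =
   t^-1 * (f x s (t * v + xi) - f x s xi).
  by field; rewrite v0 (gt_eqF t0).
rewrite mulrC ler_pdivrMr//.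
have := @hconv x s Ox t eta xi (ltW t0) t1.
have -> : t * eta + (1 - t) * xi = t * v + xi by rewrite /v; ring.
by lra.
Qed.

(** The tangent at [eta], read at [xi], bounds the increment of [f x s] by the slope at [eta] times
    [eta - xi]; exchanging that slope for the one at [xi] costs at most [2 * L * |eta - xi|]. *)
Lemma slope_le x s xi eta L : Omega x -> (forall z, `|fxi f x s z| <= L) ->
  f x s eta <= f x s xi + fxi f x s xi * (eta - xi) + 2 * L * `|eta - xi|.
Proof.
move=> Ox HL.
have H := @tangent_le x s eta xi Ox.
have H1 : fxi f x s eta * (eta - xi) <= L * `|eta - xi|.
  by apply: le_trans (ler_norm _) _; rewrite normrM ler_wpM2r.
have H2 : - (L * `|eta - xi|) <= fxi f x s xi * (eta - xi).
  rewrite lerNl -mulNr; apply: le_trans (ler_norm _) _.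
  by rewrite normrM normrN ler_wpM2r.
lra.
Qed.

Lemma compact_slope_bound a b M : `[a, b] `<=` Omega ->
  exists2 L : R, 0 <= L &
    forall x s xi, a <= x <= b -> `|s| <= M -> `|fxi f x s xi| <= L.
Proof.
move=> abO.
have cK : compact (`[a, b] `*` `[- M, M] : set (R * R)).
  by apply: compact_setX; exact: segment_compact.
have [|L [HL _]] := hLip cK.
  by move=> [x s] [/= + _]; exact: abO.
exists `|L| => // x s xi xab sM; apply: le_trans (ler_norm L).
by apply: HL; split => /=; rewrite in_itv//= -ler_norml.
Qed.

Lemma compact_slice_bound (F : R -> R -> R -> R) a b M xi : `[a, b] `<=` Omega ->
  {within [set p : R * R * R | Omega p.1.1],
    continuous (fun p : R * R * R => F p.1.1 p.1.2 p.2)} ->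
  exists2 B : R, 0 <= B &
    forall x s, a <= x <= b -> `|s| <= M -> `|F x s xi| <= B.
Proof.
move=> abO cF.
have cK : compact (`[a, b] `*` `[- M, M] : set (R * R)).
  by apply: compact_setX; exact: segment_compact.
have [|B HB] := @compact_continuous_bounded R _ (fun p : R * R => F p.1 p.2 xi) _ cK.
  by move=> [x s] [/= xab _]; apply: slice_continuous => //; exact: abO.
exists `|B| => // x s xab sM; apply: le_trans (ler_norm B).
by apply: (HB (x, s)); split => /=; rewrite in_itv//= -ler_norml.
Qed.

Lemma primitive_on_bounded a b (u w : R -> R) : primitive_on a b u w ->
  exists2 M : R, 0 <= M & forall x, a <= x <= b -> `|u x| <= M.
Proof.
move=> uw; have cu := primitive_on_continuous uw.
have [ab|ba] := leP a b; last by exists 0 => // x; lra.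
have [cM _ HM] := EVT_max ab cu; have [cm _ Hm] := EVT_min ab cu.
exists (`|u cM| + `|u cm|) => [|x xab]; first by rewrite addr_ge0.
have := HM x; have := Hm x; rewrite in_itv/= xab => /(_ isT) + /(_ isT).
have := ler_norm (u cM); have := ler_norm (- u cm); rewrite normrN.
by rewrite ler_norml => *; have := normr_ge0 (u cM); have := normr_ge0 (u cm); lra.
Qed.

Lemma primitive_on_measurable a b (u w : R -> R) : primitive_on a b u w ->
  measurable_fun `]a, b] u /\ measurable_fun `]a, b] w.
Proof.
move=> uw; split; first exact: within_measurable_itvoc (primitive_on_continuous uw).
by have [/(measurable_int mu)/measurable_EFinP] := uw.
Qed.

Lemma integrand_measurable (F : R -> R -> R -> R) a b (u w : R -> R) :
  `[a, b] `<=` Omega ->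
  {within [set p : R * R * R | Omega p.1.1],
    continuous (fun p : R * R * R => F p.1.1 p.1.2 p.2)} ->
  measurable_fun `]a, b] u -> measurable_fun `]a, b] w ->
  measurable_fun `]a, b] (fun x => F x (u x) (w x)).
Proof.
move=> abO cF mu_ mw.
apply: (@continuous_triple_measurable R `]a, b]%classic Omega) => //.
  by move=> x /subset_itv_oc_cc; exact: abO.
exact: within_fiber_continuous.
Qed.

(** Bounded slopes mean linear growth: comparison with the tangent at [xi = 0] gives at most
    [B + 3 * L * |w|]. Energies of primitives on compact intervals are therefore finite, and
    real-valued integrals can be used until the final exhaustion. *)
Lemma integrand_integrable a b (u w : R -> R) : `[a, b] `<=` Omega ->
  primitive_on a b u w ->
  mu.-integrable `]a, b] (EFin \o (fun x => f x (u x) (w x))).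
Proof.
move=> abO uw; have [mu_ mw] := primitive_on_measurable uw.
have [M M0 HM] := primitive_on_bounded uw.
have [L L0 HL] := @compact_slope_bound a b M abO.
have [B B0 HB] := @compact_slice_bound f a b M 0 abO hcont.
have mf := integrand_measurable abO hcont mu_ mw.
have [wi _] := uw.
have Bi : mu.-integrable `]a, b] (EFin \o cst B).
  by apply: (@bounded_integrable_itvoc _ _ _ _ `|B|).
have i1 := integrable_scale (3 * L) (measurable_itv _) (integrable_abs wi).
have i2 := integrable_plus (measurable_itv _) Bi i1.
apply: le_integrable i2 => //; first exact/measurable_EFinP.
move=> x; rewrite /= in_itv/= => /andP[ax xb]; rewrite lee_fin.
have xab : a <= x <= b by rewrite (ltW ax) xb.
have Ox : Omega x by apply: abO; rewrite /= in_itv.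
have sM := HM x xab.
rewrite ger0_norm ?hpos//; apply: le_trans (ler_norm _).
have := @slope_le x (u x) 0 (w x) L Ox (fun z => HL x (u x) z xab sM).
have := HB x (u x) xab sM; have := HL x (u x) 0 xab sM; rewrite subr0 => h1 h2.
have := ler_norm (f x (u x) 0).
have : fxi f x (u x) 0 * w x <= L * `|w x|.
  by apply: le_trans (ler_norm _) _; rewrite normrM ler_wpM2r.
rewrite /cst; lra.
Qed.

(** With [k = 1 / r], the factor [1 - edge_cutoff] vanishes except on strips of width [r] at the two
    ends, and absolute continuity of the integral of [|q|] bounds each strip by [e / 2]. The
    condition [r <= (b - a) / 2] keeps the strips apart. *)
Lemma edge_cutoff_loss a b (q : R -> R) : a < b ->
  mu.-integrable `]a, b] (EFin \o q) -> forall e : R, 0 < e ->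
  exists2 k : R, 0 <= k & \int[mu]_(x in `]a, b]) ((1 - edge_cutoff a b k x) * q x) <= e.
Proof.
move=> ab qi e e0; have aqi := integrable_abs qi.
have e20 : 0 < e / 2 by rewrite divr_gt0.
have [d d0 Hd] := primitive_on_unif (primitive_on_integral 0 aqi) e20.
pose r := Num.min (d / 2) ((b - a) / 2).
have r0 : 0 < r by rewrite lt_min !divr_gt0// subr_gt0.
have rd : r < d by apply: (@le_lt_trans _ _ (d / 2)); [rewrite ge_min lexx|lra].
have rb : r <= (b - a) / 2 by rewrite ge_min lexx orbT.
have k0 : 0 <= r^-1 by rewrite invr_ge0 ltW.
exists r^-1 => //.
set ph := edge_cutoff a b r^-1.
have cph : {within `[a, b], continuous ph}.
  apply/subspace_continuousP => x _; apply: cvg_within_filter.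
  by apply: (@lip_continuous _ _ r^-1) => y; exact: edge_cutoff_lip.
have ph01 x : a < x <= b -> 0 <= ph x <= 1.
  by move=> /andP[ax xb]; apply: edge_cutoff01; rewrite // (ltW ax).
have mph : measurable_fun `]a, b] (fun x => 1 - ph x).
  apply: within_measurable_itvoc => x; apply: cvgB; first exact: cvg_cst.
  exact: cph.
have pqi : mu.-integrable `]a, b] (EFin \o (fun x => (1 - ph x) * q x)).
  apply: (@integrable_itvoc_bddM _ _ _ _ _ 1) => // x /ph01 /andP[h1 h2].
  by rewrite ger0_norm; lra.
have small x y : a <= x -> x <= y -> y <= b -> y - x < d ->
    \int[mu]_(t in `]x, y]) ((1 - ph t) * q t) <= e / 2.
  move=> ax xy yb yxd.
  have := Hd y x; rewrite ax yb (le_trans ax xy) (le_trans xy yb) => /(_ isT isT).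
  rewrite ger0_norm ?subr_ge0// => /(_ yxd).
  have [_ /(_ x y ax xy yb) ->] := primitive_on_integral 0 aqi.
  move=> h1; apply: le_trans (ltW h1); apply: le_trans (ler_norm _) _.
  apply: le_trans (ler_norm _).
  apply: Rintegral_abs_le => //.
  - exact: integrable_itvoc_sub pqi.
  - exact: integrable_itvoc_sub aqi.
  move=> t; rewrite /= in_itv/= => /andP[xt ty].
  have /ph01 /andP[h3 h4] : a < t <= b by rewrite (le_lt_trans ax xt) (le_trans ty yb).
  by rewrite normrM ler_piMl// ger0_norm; lra.
have c1 : a <= a + r by lra.
have c2 : a + r <= b - r by lra.
have c3 : b - r <= b by lra.
rewrite (Rintegral_itvoc_cat c1 (le_trans c2 c3) pqi).
rewrite (Rintegral_itvoc_cat c2 c3); last exact: integrable_itvoc_sub pqi.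
rewrite [X in _ + (X + _)](_ : _ = 0).
  rewrite add0r [e]splitr; apply: lerD; apply: small => //; lra.
rewrite (@eq_Rintegral _ _ _ _ _ (cst 0)); first by rewrite Rintegral_cst// mul0r.
move=> t; rewrite inE/= in_itv/= => /andP[h1 h2].
rewrite /ph edge_cutoff1 ?subrr ?mul0r//.
  by rewrite mulrC ler_pdivlMr//; lra.
by rewrite mulrC ler_pdivlMr//; lra.
Qed.

(** Pointwise, [|g x s - g x t| <= e / (b - a) + 2 * B / d * |s - t|]: uniform continuity covers
    [|s - t| < d], and boundedness the rest. *)
Lemma value_continuity a b (B : R) (g : R -> R -> R) : a < b ->
  (forall x s, a <= x <= b -> `|g x s| <= B) ->
  (forall e : R, 0 < e -> exists2 d : R, 0 < d &
    forall x y s t, a <= x <= b -> a <= y <= b -> `|x - y| < d -> `|s - t| < d ->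
    `|g x s - g y t| < e) ->
  forall e : R, 0 < e -> exists2 C : R, 0 <= C &
  forall u w v z, primitive_on a b u w -> primitive_on a b v z ->
  `|\int[mu]_(x in `]a, b]) g x (u x) - \int[mu]_(x in `]a, b]) g x (v x)| <=
  e + C * \int[mu]_(x in `]a, b]) `|u x - v x|.
Proof.
move=> ab gB guc e e0.
have ba0 : 0 < b - a by rewrite subr_gt0.
have e10 : 0 < e / (b - a) by rewrite divr_gt0.
have [d d0 Hd] := guc _ e10.
have B0 : 0 <= B by apply: le_trans (gB a 0 _); rewrite // lexx ltW.
exists (2 * B / d); first by rewrite divr_ge0 ?(ltW d0)// mulr_ge0.
move=> u w v z uw vz.
have gi f' w' : primitive_on a b f' w' -> mu.-integrable `]a, b] (EFin \o (fun x => g x (f' x))).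
  move=> fw; apply: within_integrable_itvoc; apply: unif_continuous_itv.
  exact: (comp_unif guc fw).
have di := primitive_diff_integrable uw vz.
have ci : mu.-integrable `]a, b] (EFin \o cst (e / (b - a))).
  by apply: (@bounded_integrable_itvoc _ _ _ _ `|e / (b - a)|).
have cdi := integrable_scale (2 * B / d) (measurable_itv _) di.
have -> : e = \int[mu]_(x in `]a, b]) (e / (b - a)).
  by rewrite Rintegral_cst// mu_itvoc ?ltW// divfK// gt_eqF.
rewrite -RintegralB//; [|exact: gi uw|exact: gi vz].
rewrite -RintegralZl// -RintegralD//.
apply: Rintegral_abs_le => //.
- exact: (integrable_minus (measurable_itv _) (gi _ _ uw) (gi _ _ vz)).
- exact: (integrable_plus (measurable_itv _) ci cdi).
move=> x; rewrite /= in_itv/= => /andP[ax xb].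
have xab : a <= x <= b by rewrite (ltW ax) xb.
have [sd|ds] := ltP `|u x - v x| d.
  apply: (@le_trans _ _ (e / (b - a))).
    by apply/ltW/Hd => //; rewrite subrr normr0.
  by rewrite lerDl mulr_ge0// divr_ge0 ?(ltW d0)// mulr_ge0.
apply: le_trans (ler_normB _ _) _; apply: le_trans (lerD (gB x _ xab) (gB x _ xab)) _.
have h : 2 * B <= 2 * B / d * `|u x - v x|.
  by rewrite mulrAC ler_pdivlMr// ler_wpM2l// mulr_ge0.
have := ltW e10; lra.
Qed.

Hypothesis hAC : forall (O' H K : set R), compact O' -> O' `<=` Omega ->
  compact H -> compact K ->
  forall eps : R, 0 < eps -> exists2 delta : R, 0 < delta &
    forall s xi, H s -> K xi ->
    forall (N : nat) (a b : nat -> R),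
      (forall i, (i < N)%N -> a i < b i /\ `]a i, b i[ `<=` O') ->
      (forall i j, (i < N)%N -> (j < N)%N -> i <> j ->
         `]a i, b i[ `&` `]a j, b j[ = set0) ->
      \sum_(i < N) (b i - a i) < delta ->
      \sum_(i < N) `|fxi f (b i) s xi - fxi f (a i) s xi| < eps.

(** The increment of the product splits as in the product rule. The increments of [fxi f] fall under
    [grid_variation] for levels in [[-(M + 1), M + 1]], those of the edge cutoff add at most
    [L * k * h] per cell, and the plateau, constant in [x], only shrinks the sum. *)
Lemma cutoff_slope_variation a b k M xi : a < b -> `[a, b] `<=` Omega -> 0 <= k ->
  forall e : R, 0 < e -> exists C h0 : R, [/\ 0 <= C, 0 < h0 &
  forall N, (0 < N)%N -> let h := (b - a) / N%:R in h < h0 ->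
  forall (t : R) (P : pred nat),
    \sum_(i < N | P i)
      `|edge_cutoff a b k (grid a h i.+1) * plateau M t * fxi f (grid a h i.+1) t xi -
        edge_cutoff a b k (grid a h i) * plateau M t * fxi f (grid a h i) t xi| <=
    e + \sum_(i < N | P i) C * h].
Proof.
move=> ab abO k0 e e0.
have [L L0 HL] := @compact_slope_bound a b (M + 1) abO.
have AC : forall eps : R, 0 < eps -> exists2 delta : R, 0 < delta &
     forall s, `[- (M + 1), M + 1]%classic s -> forall (N : nat) (x y : nat -> R),
       (forall i, (i < N)%N -> x i < y i /\ `]x i, y i[ `<=` `[a, b]) ->
       (forall i j, (i < N)%N -> (j < N)%N -> i <> j ->
          `]x i, y i[ `&` `]x j, y j[ = set0) ->
       \sum_(i < N) (y i - x i) < delta ->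
       \sum_(i < N) `|fxi f (y i) s xi - fxi f (x i) s xi| < eps.
  move=> eps eps0.
  have [d d0 Hd] := hAC (@segment_compact _ a b) abO
    (@segment_compact _ (- (M + 1)) (M + 1)) (@compact_set1 R xi) eps0.
  by exists d => // s sM; apply: Hd.
have [C [h0 [C0 h00 HV]]] := @grid_variation R a b (fun x s => fxi f x s xi) _ ab AC e e0.
exists (C + L * k), h0; split => //; first by rewrite addr_ge0 ?mulr_ge0.
move=> N N0 h hh0 t P.
have h_ge0 : 0 <= h by rewrite divr_ge0 ?subr_ge0 ?ltW// ltr0n.
have [tM|Mt] := leP `|t| (M + 1); last first.
  rewrite big1 ?addr_ge0 ?(ltW e0)//.
    by apply: sumr_ge0 => i _; rewrite mulr_ge0// addr_ge0// mulr_ge0.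
  by move=> i _; rewrite plateau0// !(mulr0, mul0r) subrr normr0.
have tH : `[- (M + 1), M + 1]%classic t by rewrite /= in_itv/= -ler_norml.
have := HV N N0 hh0 t P tH; rewrite -/h => HV1.
have -> : \sum_(i < N | P i) (C + L * k) * h =
  \sum_(i < N | P i) C * h + \sum_(i < N | P i) L * k * h.
  by rewrite -big_split/=; apply: eq_bigr => i _; rewrite mulrDl.
rewrite addrA; apply: le_trans (lerD HV1 (lexx _)); rewrite -big_split/=.
apply: ler_sum => i _.
have inN j : (j <= N)%N -> a <= grid a h j <= b by move=> jN; exact: grid_in.
have y1 := inN _ (ltn_ord i); have x1 := inN _ (ltnW (ltn_ord i)).
set y := grid a h i.+1 in y1 *; set x := grid a h i in x1 *.
have /andP[p0 p1] := plateau01 M t.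
have /andP[c0 c1] := edge_cutoff01 k0 y1.
have -> : edge_cutoff a b k y * plateau M t * fxi f y t xi -
   edge_cutoff a b k x * plateau M t * fxi f x t xi =
   plateau M t * (edge_cutoff a b k y * (fxi f y t xi - fxi f x t xi) +
   (edge_cutoff a b k y - edge_cutoff a b k x) * fxi f x t xi) by ring.
rewrite normrM (ger0_norm p0); apply: le_trans (ler_piMl _ p1) _ => //.
apply: le_trans (ler_normD _ _) _; apply: lerD.
  by rewrite normrM (ger0_norm c0) ler_piMl.
rewrite normrM.
have := edge_cutoff_lip a b y x k0.
have -> : `|y - x| = h by rewrite /y /x gridS addrAC subrr add0r ger0_norm.
move=> h1; have -> : L * k * h = (k * h) * L by ring.
by apply: ler_pM => //; exact: HL.
Qed.

(** An instance of [pairing_continuity] with [T = M + 1] and [B = L]: the edge cutoff provides the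
    zeros at both ends, the plateau the bounded support in [s]. *)
Lemma cutoff_slope_pairing a b k M xi : a < b -> `[a, b] `<=` Omega -> 0 <= k -> 0 <= M ->
  forall e : R, 0 < e -> exists2 C : R, 0 <= C &
  forall u w v z, primitive_on a b u w -> primitive_on a b v z ->
  `|\int[mu]_(x in `]a, b])
      (edge_cutoff a b k x * plateau M (u x) * fxi f x (u x) xi * w x) -
    \int[mu]_(x in `]a, b])
      (edge_cutoff a b k x * plateau M (v x) * fxi f x (v x) xi * z x)| <=
  e + C * \int[mu]_(x in `]a, b]) `|u x - v x|.
Proof.
move=> ab abO k0 M0; have [L L0 HL] := @compact_slope_bound a b (M + 1) abO.
apply: (@pairing_continuity R a b (M + 1) L
  (fun x s => edge_cutoff a b k x * plateau M s * fxi f x s xi)) => //.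
- by rewrite addr_ge0.
- by move=> x s _ Ms; rewrite plateau0// mulr0 mul0r.
- move=> x s xab; have [sM|Ms] := leP `|s| (M + 1); last first.
    by rewrite plateau0// mulr0 mul0r normr0.
  have /andP[c0 c1] := edge_cutoff01 k0 xab; have /andP[p0 p1] := plateau01 M s.
  rewrite normrM; apply: le_trans (HL x s xi xab sM); apply: ler_piMl => //.
  by rewrite ger0_norm ?mulr_ge0// mulr_ile1.
- apply: (cutoff_unif M k0) => x s xab; apply: slice_continuous => //; exact: abO.
- by move=> s; rewrite edge_cutoff_l ?mul0r// ltW.
- by move=> s; rewrite edge_cutoff_r ?mul0r// ltW.
- exact: cutoff_slope_variation.
Qed.

(** The tangent at [xi] is [(f - fxi * xi) + fxi * v']. Its part free of [v'] is bounded and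
    uniformly continuous after the cutoffs, so [value_continuity] applies. *)
Lemma cutoff_value_continuity a b k M xi : a < b -> `[a, b] `<=` Omega -> 0 <= k -> 0 <= M ->
  forall e : R, 0 < e -> exists2 C : R, 0 <= C &
  forall u w v z, primitive_on a b u w -> primitive_on a b v z ->
  `|\int[mu]_(x in `]a, b])
      (edge_cutoff a b k x * plateau M (u x) * (f x (u x) xi - fxi f x (u x) xi * xi)) -
    \int[mu]_(x in `]a, b])
      (edge_cutoff a b k x * plateau M (v x) * (f x (v x) xi - fxi f x (v x) xi * xi))| <=
  e + C * \int[mu]_(x in `]a, b]) `|u x - v x|.
Proof.
move=> ab abO k0 M0; have [L L0 HL] := @compact_slope_bound a b (M + 1) abO.
have [B B0 HB] := @compact_slice_bound f a b (M + 1) xi abO hcont.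
apply: (@value_continuity a b (B + L * `|xi|)
  (fun x s => edge_cutoff a b k x * plateau M s * (f x s xi - fxi f x s xi * xi))) => //.
- move=> x s xab; have [sM|Ms] := leP `|s| (M + 1); last first.
    by rewrite plateau0// mulr0 mul0r normr0 addr_ge0// mulr_ge0.
  have /andP[c0 c1] := edge_cutoff01 k0 xab; have /andP[p0 p1] := plateau01 M s.
  rewrite normrM; apply: le_trans (ler_piMl _ _) _ => //.
    by rewrite ger0_norm ?mulr_ge0// mulr_ile1.
  apply: le_trans (ler_normB _ _) _; apply: lerD; first exact: HB.
  by rewrite normrM ler_wpM2r//; exact: HL.
- apply: (@cutoff_unif R a b k M (fun x s => f x s xi - fxi f x s xi * xi) k0) => x s xab.
  have Ox : Omega x by exact: abO.
  apply: cvgB; first exact: slice_continuous.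
  by apply: cvgM; [exact: slice_continuous|exact: cvg_cst].
Qed.

Lemma cutoff_continuous a b k M (F : R -> R -> R) (u w : R -> R) : 0 <= k ->
  (forall x s, a <= x <= b -> {for (x, s), continuous (fun p : R * R => F p.1 p.2)}) ->
  primitive_on a b u w ->
  {within `[a, b], continuous (fun x => edge_cutoff a b k x * plateau M (u x) * F x (u x))}.
Proof.
move=> k0 cF uw; apply: unif_continuous_itv.
exact: (comp_unif (g := fun x s => edge_cutoff a b k x * plateau M s * F x s)
  (cutoff_unif M k0 cF) uw).
Qed.

(** Tangents at [xi] serve in both directions. Along [V], the tangent times the cutoffs stays below
    [f]. Along [U], where the plateau is [1], [slope_le] puts [f] below the tangent up to
    [2 * L * |W - xi|]. Continuity compares the two cut-off tangents. The thirds of [e] pay for the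
    edge loss, the slope pairing and the value term. *)
Lemma const_slope_lower_bound a b (U W : R -> R) M L xi : a < b -> `[a, b] `<=` Omega ->
  primitive_on a b U W -> 0 <= M -> (forall x, a <= x <= b -> `|U x| <= M) ->
  (forall x s z, a <= x <= b -> `|s| <= M -> `|fxi f x s z| <= L) ->
  forall e : R, 0 < e -> exists2 C : R, 0 <= C &
  forall V Z, primitive_on a b V Z ->
  \int[mu]_(x in `]a, b]) f x (U x) (W x) <=
  \int[mu]_(x in `]a, b]) f x (V x) (Z x) +
  2 * L * (\int[mu]_(x in `]a, b]) `|W x - xi|) + e +
  C * \int[mu]_(x in `]a, b]) `|V x - U x|.
Proof.
move=> ab abO UW M0 UM HL e e0.
have Oab x : a < x <= b -> Omega x.
  by move=> /andP[ax xb]; apply: abO; rewrite /= in_itv/= (ltW ax).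
have cab x : a < x <= b -> a <= x <= b by move=> /andP[/ltW -> ->].
have [Wi _] := UW; have [mU mW] := primitive_on_measurable UW.
have mO := measurable_itv `]a, b].
have ci (c : R) : mu.-integrable `]a, b] (EFin \o cst c).
  by apply: (@bounded_integrable_itvoc _ _ _ _ `|c|).
have mS : measurable_fun `]a, b] (fun x => fxi f x (U x) xi).
  by apply: (@integrand_measurable (fxi f) a b U (cst xi)).
pose q x := f x (U x) xi + fxi f x (U x) xi * (W x - xi).
have Wxi : mu.-integrable `]a, b] (EFin \o (fun x => W x - xi)).
  exact: (integrable_minus mO Wi (ci xi)).
have SWi : mu.-integrable `]a, b] (EFin \o (fun x => fxi f x (U x) xi * (W x - xi))).
  by apply: (@integrable_itvoc_bddM _ _ _ _ _ L) => // x /cab xab; apply: HL => //; exact: UM.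
have qi : mu.-integrable `]a, b] (EFin \o q).
  apply: integrable_plus => //.
  have [B B0 HB] := @compact_slice_bound f a b M xi abO hcont.
  apply: (@bounded_integrable_itvoc _ _ _ _ B).
    by apply: (@integrand_measurable f a b U (cst xi)).
  by move=> x /cab xab; apply: HB => //; exact: UM.
have e30 : 0 < e / 3 by rewrite divr_gt0.
(* The steepness is fixed by [U], [W] and [xi], so the constants obtained next do not depend on
   [V]. *)
have [k k0 Hk] := edge_cutoff_loss ab (integrable_abs qi) e30.
have [C1 C10 H1] := @cutoff_slope_pairing a b k M xi ab abO k0 M0 _ e30.
have [C2 C20 H2] := @cutoff_value_continuity a b k M xi ab abO k0 M0 _ e30.
exists (C1 + C2); first exact: addr_ge0.
move=> V Z VZ; have {}H1 := H1 _ _ _ _ VZ UW; have {}H2 := H2 _ _ _ _ VZ UW.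
set D := \int[mu]_(x in _) `|V x - U x| in H1 H2 *.
pose h (u : R -> R) x :=
  edge_cutoff a b k x * plateau M (u x) * (f x (u x) xi - fxi f x (u x) xi * xi).
pose g (u : R -> R) x := edge_cutoff a b k x * plateau M (u x) * fxi f x (u x) xi.
have ph01 x : a < x <= b -> 0 <= edge_cutoff a b k x <= 1.
  by move=> xab; apply: edge_cutoff01 => //; exact: cab.
have hi u w : primitive_on a b u w -> mu.-integrable `]a, b] (EFin \o h u).
  move=> uw; apply: within_integrable_itvoc.
  apply: (@cutoff_continuous a b k M (fun x s => f x s xi - fxi f x s xi * xi) u w) => // x s xab.
  have Ox : Omega x by exact: abO.
  apply: cvgB; first exact: slice_continuous.
  by apply: cvgM; [exact: slice_continuous|exact: cvg_cst].
have gi u w : primitive_on a b u w -> mu.-integrable `]a, b] (EFin \o (fun x => g u x * w x)).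
  move=> uw; have [wi _] := uw.
  have cg : {within `[a, b], continuous (g u)}.
    apply: (@cutoff_continuous a b k M (fun x s => fxi f x s xi) u w) => // x s xab.
    by apply: slice_continuous => //; exact: abO.
  have [L' L'0 HL'] := @compact_slope_bound a b (M + 1) abO.
  apply: (@integrable_itvoc_bddM _ _ _ _ _ L') => //; first exact: within_measurable_itvoc.
  move=> x xab; have [sM|Ms] := leP `|u x| (M + 1); last first.
    by rewrite /g plateau0// mulr0 mul0r normr0.
  have /andP[c0 c1] := ph01 x xab; have /andP[p0 p1] := plateau01 M (u x).
  rewrite normrM; apply: le_trans (HL' x (u x) xi (cab _ xab) sM); apply: ler_piMl => //.
  by rewrite ger0_norm ?mulr_ge0// mulr_ile1.
have fVi := integrand_integrable abO VZ; have fUi := integrand_integrable abO UW.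
have step1 : \int[mu]_(x in `]a, b]) h V x + \int[mu]_(x in `]a, b]) (g V x * Z x) <=
    \int[mu]_(x in `]a, b]) f x (V x) (Z x).
  rewrite -RintegralD//; [|exact: hi VZ|exact: gi VZ].
  apply: le_Rintegral => //; first exact: (integrable_plus mO (hi _ _ VZ) (gi _ _ VZ)).
  move=> x; rewrite /= in_itv/= => xab.
  have /andP[c0 c1] := ph01 x xab; have /andP[p0 p1] := plateau01 M (V x).
  have -> : h V x + g V x * Z x = edge_cutoff a b k x * plateau M (V x) *
      (f x (V x) xi + fxi f x (V x) xi * (Z x - xi)) by rewrite /h /g; ring.
  have cp0 : 0 <= edge_cutoff a b k x * plateau M (V x) by rewrite mulr_ge0.
  apply: le_trans (ler_wpM2l cp0 (@tangent_le x (V x) xi (Z x) (Oab x xab))) _.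
  by rewrite ler_piMl ?mulr_ile1//; apply: hpos; exact: Oab.
have pqi : mu.-integrable `]a, b] (EFin \o (fun x => h U x + g U x * W x)).
  exact: (integrable_plus mO (hi _ _ UW) (gi _ _ UW)).
have lqi : mu.-integrable `]a, b] (EFin \o (fun x => (1 - edge_cutoff a b k x) * `|q x|)).
  apply: (@integrable_itvoc_bddM _ _ _ _ _ 1); last exact: integrable_abs.
    apply: within_measurable_itvoc => x; apply: cvgB; first exact: cvg_cst.
    move: x; apply/subspace_continuousP => x _; apply: cvg_within_filter.
    by apply: (@lip_continuous _ _ k) => y; exact: edge_cutoff_lip.
  by move=> x /ph01 /andP[h1 h2]; rewrite ger0_norm ?subr_ge0// lerBlDr lerDl.
have aWi := integrable_scale (2 * L) mO (integrable_abs Wxi).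
have step2 : \int[mu]_(x in `]a, b]) f x (U x) (W x) <=
    \int[mu]_(x in `]a, b]) h U x + \int[mu]_(x in `]a, b]) (g U x * W x) +
    \int[mu]_(x in `]a, b]) ((1 - edge_cutoff a b k x) * `|q x|) +
    2 * L * \int[mu]_(x in `]a, b]) `|W x - xi|.
  rewrite -RintegralD//; [|exact: hi UW|exact: gi UW].
  rewrite -RintegralZl//; last exact: integrable_abs.
  rewrite -RintegralD// -RintegralD//; last exact: (integrable_plus mO pqi lqi).
  apply: le_Rintegral => //.
    exact: (integrable_plus mO (integrable_plus mO pqi lqi) aWi).
  move=> x; rewrite /= in_itv/= => xab.
  have /andP[c0 c1] := ph01 x xab; have UxM := UM x (cab x xab).
  have E : h U x + g U x * W x = edge_cutoff a b k x * q x.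
    by rewrite /h /g /q plateau1//; ring.
  rewrite E.
  have sl := @slope_le x (U x) xi (W x) L (Oab x xab) (fun z => HL x _ z (cab x xab) UxM).
  apply: le_trans sl _; rewrite lerD2r -/(q x).
  have := ler_norm (q x); move: (edge_cutoff a b k x) c0 c1 => c c0 c1 nq.
  have : (1 - c) * q x <= (1 - c) * `|q x| by rewrite ler_wpM2l// subr_ge0.
  by rewrite mulrBl mul1r lerBlDr addrC.
move: H1 H2; rewrite !ler_norml => /andP[H1 _] /andP[H2 _].
move: H1 H2; rewrite -/(h V) -/(h U) => H1 H2.
have {H1}H1 : - (e / 3 + C1 * D) <= \int[mu]_(x in `]a, b]) (g V x * Z x) -
   \int[mu]_(x in `]a, b]) (g U x * W x) by exact: H1.
have {H2}H2 : - (e / 3 + C2 * D) <= \int[mu]_(x in `]a, b]) h V x -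
   \int[mu]_(x in `]a, b]) h U x by exact: H2.
move: step1 step2 H1 H2 Hk; clearbody D; rewrite mulrDl.
move: (\int[mu]_(x in `]a, b]) f x (V x) (Z x)) => IfV.
move: (\int[mu]_(x in `]a, b]) f x (U x) (W x)) => IfU.
move: (\int[mu]_(x in `]a, b]) h V x) => IhV.
move: (\int[mu]_(x in `]a, b]) h U x) => IhU.
move: (\int[mu]_(x in `]a, b]) (g V x * Z x)) => IgV.
move: (\int[mu]_(x in `]a, b]) (g U x * W x)) => IgU.
move: (\int[mu]_(x in `]a, b]) ((1 - edge_cutoff a b k x) * `|q x|)) => Iq.
move: (\int[mu]_(x in `]a, b]) `|W x - xi|) => IW.
clear; lra.
Qed.

(** [W] is approximated in L1 by a continuous [c], whose values at the left ends of grid cells serve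
    as frozen slopes. The grid is determined before [V] appears, so finitely many constants are
    added. *)
Lemma primitive_lower_bound a b (U W : R -> R) : a < b -> `[a, b] `<=` Omega ->
  primitive_on a b U W ->
  forall e : R, 0 < e -> exists2 C : R, 0 <= C &
  forall V Z, primitive_on a b V Z ->
  \int[mu]_(x in `]a, b]) f x (U x) (W x) <=
  \int[mu]_(x in `]a, b]) f x (V x) (Z x) + e +
  C * \int[mu]_(x in `]a, b]) `|V x - U x|.
Proof.
move=> ab abO UW e e0; have [Wi _] := UW.
have [M M0 UM] := primitive_on_bounded UW.
have [L L0 HL] := @compact_slope_bound a b M abO.
have ba0 : 0 < b - a by rewrite subr_gt0.
have mO := measurable_itv `]a, b].
(* The step function is within [2 * e1] of [W], half from [c] and half from its oscillation, at a
   cost of [2 * L * (2 * e1) <= 2 * e / 3]. The last third is shared by the [N] cells as [e']. *)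
pose e1 := e / (3 * (2 * L + 1)).
have e10 : 0 < e1 by rewrite divr_gt0// mulr_gt0// ltr_wpDl// mulr_ge0.
have [c [cc ci Hc]] : exists c : R -> R, [/\ continuous c,
    mu.-integrable `]a, b] (EFin \o c) & \int[mu]_(x in `]a, b]) `|W x - c x| <= e1].
  have [c_ [cc ci Hc]] := @approximation_continuous_integrable R `]a, b]%classic W
    (measurable_itv _) (mu_itvoc_fin a b) Wi.
  have /fine_cvgP[_ /cvgrPdist_le/(_ _ e10)[n _ Hn]] := Hc.
  exists (c_ n); split => //; have := Hn n (leqnn n).
  by rewrite /= sub0r normrN; apply: le_trans; exact: ler_norm.
have [d d0 Hd] : exists2 d : R, 0 < d & forall x y, a <= x <= b -> `|x - y| < d ->
    `|c x - c y| < e1 / (b - a).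
  have e20 : 0 < e1 / (b - a) by rewrite divr_gt0.
  have [d d0 Hd] := compact_unif_continuous (@segment_compact R a b) (fun p _ => cc p) e20.
  by exists d => // x y xab; apply: Hd; rewrite /= in_itv.
pose N := (Num.truncn ((b - a) / d)).+1.
pose h := (b - a) / N%:R.
have hd : h < d.
  rewrite /h ltr_pdivrMr ?ltr0n// mulrC -ltr_pdivrMr// /N; exact: truncnS_gt.
have N0 : (0 < N)%N by [].
have h0 : 0 < h by rewrite divr_gt0// ltr0n.
have inN i : (i <= N)%N -> a <= grid a h i <= b by move=> iN; exact: grid_in.
pose e' := e / 3 / N%:R.
have e'0 : 0 < e' by rewrite !divr_gt0// ltr0n.
pose I j := \int[mu]_(x in `]grid a h j, grid a h j.+1]) `|W x - c (grid a h j)|.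
(* The constants of the cells are added one at a time, the distance over each cell being enlarged to
   the one over []a, b]]. *)
have claim i : (i <= N)%N -> exists2 C : R, 0 <= C & forall V Z, primitive_on a b V Z ->
    \int[mu]_(x in `]a, grid a h i]) f x (U x) (W x) <=
    \int[mu]_(x in `]a, grid a h i]) f x (V x) (Z x) +
    \sum_(j < i) (2 * L * I j + e') + C * \int[mu]_(x in `]a, b]) `|V x - U x|.
  elim: i => [_|i IH iN].
    exists 0 => // V Z _.
    by rewrite grid0 big_ord0 set_itv_ge ?bnd_simp ?ltxx// !Rintegral_set0 mul0r !addr0.
  have [C C0 HC] := IH (ltnW iN).
  have /andP[ax xb] := inN i (ltnW iN); have /andP[ay yb] := inN i.+1 iN.
  have xy : grid a h i < grid a h i.+1 by rewrite gridS ltrDl.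
  have xyO : `[grid a h i, grid a h i.+1] `<=` Omega.
    move=> z; rewrite /= in_itv/= => /andP[xz zy]; apply: abO; rewrite /= in_itv/=.
    by rewrite (le_trans ax xz) (le_trans zy yb).
  have UWi := primitive_on_sub ax yb UW.
  have UMi z : grid a h i <= z <= grid a h i.+1 -> `|U z| <= M.
    by move=> /andP[xz zy]; apply: UM; rewrite (le_trans ax xz) (le_trans zy yb).
  have HLi z s eta : grid a h i <= z <= grid a h i.+1 -> `|s| <= M -> `|fxi f z s eta| <= L.
    by move=> /andP[xz zy]; apply: HL; rewrite (le_trans ax xz) (le_trans zy yb).
  have [C' C'0 HC'] := const_slope_lower_bound (c (grid a h i)) xy xyO UWi M0 UMi HLi e'0.
  exists (C + C'); first exact: addr_ge0.
  move=> V Z VZ; have {}HC := HC V Z VZ.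
  have {}HC' := HC' V Z (primitive_on_sub ax yb VZ).
  have fi u w : primitive_on a b u w ->
      mu.-integrable `]a, grid a h i.+1] (EFin \o (fun x => f x (u x) (w x))).
    move=> uw; apply: (integrable_itvoc_sub (lexx a) yb); exact: integrand_integrable abO uw.
  rewrite (Rintegral_itvoc_cat ax (ltW xy) (fi _ _ UW)).
  rewrite (Rintegral_itvoc_cat ax (ltW xy) (fi _ _ VZ)) big_ord_recr/=.
  have di := primitive_diff_integrable VZ UW.
  have HD : \int[mu]_(x in `]grid a h i, grid a h i.+1]) `|V x - U x| <=
      \int[mu]_(x in `]a, b]) `|V x - U x|.
    rewrite (Rintegral_itvoc_cat ay yb di).
    rewrite (Rintegral_itvoc_cat ax (ltW xy)); last exact: integrable_itvoc_sub di.
    by rewrite addrAC lerDr addr_ge0//; apply: Rintegral_ge0.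
  have := ler_wpM2l C'0 HD; move: HC HC'; rewrite -/(I i).
  move: (\int[mu]_(x in `]a, grid a h i]) f x (U x) (W x)) => X1.
  move: (\int[mu]_(x in `]a, grid a h i]) f x (V x) (Z x)) => X2.
  move: (\int[mu]_(x in `]grid a h i, grid a h i.+1]) f x (U x) (W x)) => X3.
  move: (\int[mu]_(x in `]grid a h i, grid a h i.+1]) f x (V x) (Z x)) => X4.
  move: (\int[mu]_(x in `]a, b]) `|V x - U x|) => X5.
  move: (\int[mu]_(x in `]grid a h i, grid a h i.+1]) `|V x - U x|) => X6.
  move: (\sum_(j < i) _) => X7; move: (I i) => X8.
  clear; rewrite mulrDl; lra.
have [C C0 HC] := claim N (leqnn N); exists C => // V Z VZ.
have := HC V Z VZ; rewrite grid_end// => /le_trans; apply.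
rewrite lerD2r lerD2l big_split/= -mulr_sumr.
rewrite sumr_const card_ord -[e' *+ N]mulr_natr.
have -> : e' * N%:R = e / 3 by rewrite /e' divfK// pnatr_eq0.
have Wci : mu.-integrable `]a, b] (EFin \o (fun x => `|W x - c x|)).
  by apply: integrable_abs; exact: integrable_minus.
have HI : \sum_(j < N) I j <= 2 * e1.
  have -> : 2 * e1 = e1 + \sum_(j < N) h * (e1 / (b - a)).
    rewrite sumr_const card_ord -[_ *+ N]mulr_natr /h.
    by field; rewrite pnatr_eq0 gt_eqF.
  have := @Rintegral_grid _ a h N _ (ltW h0); rewrite grid_end// => RG.
  apply: le_trans (lerD Hc (lexx _)).
  rewrite (RG _ Wci) -big_split/=; apply: ler_sum => j _.
  have /andP[ax xb] := inN j (ltnW (ltn_ord j)); have /andP[ay yb] := inN j.+1 (ltn_ord j).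
  have xy : grid a h j <= grid a h j.+1 by rewrite gridS lerDl ltW.
  have hE : fine (mu `]grid a h j, grid a h j.+1]) = h by rewrite mu_itvoc// gridS; ring.
  have k0i (k : R) : mu.-integrable `]grid a h j, grid a h j.+1] (EFin \o cst k).
    by apply: (@bounded_integrable_itvoc _ _ _ _ `|k|).
  have Wi' := integrable_itvoc_sub ax yb Wi.
  rewrite -[X in X * _]hE [_ * (e1 / _)]mulrC -Rintegral_cst// -RintegralD//; last 2 first.
    exact: integrable_itvoc_sub Wci.
    exact: k0i.
  apply: le_Rintegral => //.
  - by apply: integrable_abs; apply: integrable_minus => //; exact: k0i.
  - apply: integrable_plus => //; [exact: integrable_itvoc_sub Wci|exact: k0i].
  move=> t; rewrite /= in_itv/= => /andP[xt ty].
  have -> : W t - c (grid a h j) = (W t - c t) - (c (grid a h j) - c t) by ring.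
  apply: le_trans (ler_normB _ _) _; rewrite lerD2l; apply/ltW/Hd.
    by rewrite ax xb.
  rewrite distrC ger0_norm ?subr_ge0 ?ltW//; move: ty; rewrite gridS; lra.
have H2 : 2 * L * \sum_(j < N) I j <= 2 * L * (2 * e1) by rewrite ler_wpM2l// mulr_ge0.
have H3 : 2 * L * (2 * e1) <= 2 * e / 3.
  have -> : 2 * L * (2 * e1) = (2 * e / 3) * ((2 * L) / (2 * L + 1)).
    rewrite /e1; field; lra.
  rewrite -[leRHS]mulr1 ler_wpM2l ?ler_pdivrMr//; lra.
apply: le_trans (lerD (le_trans H2 H3) (lexx _)) _; lra.
Qed.

End convex_integrand.

(** * A smooth step function *)

Section elementary_smooth_functions.
Context {R : realType}.

(** The function [x^(-k) * exp(-1/x)] extended by zero. Carrying the power keeps derivatives within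
    combinations of the same family; derivatives of all orders are needed because [test_fun] asks
    for them. *)
Definition flat (k : nat) (x : R) : R :=
  if 0 < x then x^-1 ^+ k * expR (- x^-1) else 0.

Lemma flat_ge0 (k : nat) (x : R) : 0 <= flat k x.
Proof.
rewrite /flat; case: ifP => // x0.
by rewrite mulr_ge0 ?expR_ge0// exprn_ge0// invr_ge0 ltW.
Qed.

(** Comes from [exp(1/x) >= x^(-(k+2)) / (k+2)!]. The square makes the difference quotient at the
    junction point [0] tend to zero. *)
Lemma flat_quadratic k : exists2 C : R, 0 <= C & forall x, `|flat k x| <= C * x ^+ 2.
Proof.
exists (k.+2)`!%:R => // x; rewrite ger0_norm ?flat_ge0// /flat.
case: ifP => x0; last by rewrite mulr_ge0// sqr_ge0.
have xi0 : 0 <= x^-1 by rewrite invr_ge0 ltW.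
have H := @expR_ge1Dxn R x^-1 k.+1 xi0.
have f0 : 0 < (k.+2)`!%:R :> R by rewrite ltr0n fact_gt0.
have {}H : x^-1 ^+ k.+2 <= (k.+2)`!%:R * expR x^-1.
  by rewrite mulrC -ler_pdivrMr//; apply: le_trans H; rewrite lerDr.
rewrite expRN ler_pdivrMr ?expR_gt0//.
have -> : x^-1 ^+ k = x^-1 ^+ k.+2 * x ^+ 2.
  by rewrite -addn2 exprD -mulrA -exprMn mulVf ?gt_eqF// expr1n mulr1.
have -> : (k.+2)`!%:R * x ^+ 2 * expR x^-1 = (k.+2)`!%:R * expR x^-1 * x ^+ 2 by ring.
by rewrite ler_wpM2r// sqr_ge0.
Qed.

Lemma flat_is_derive (k : nat) (x : R) :
  is_derive x 1 (flat k) (- k%:R * flat k.+1 x + flat k.+2 x).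
Proof.
have [x0|x0|->] := ltgtP x 0.
- have -> : - k%:R * flat k.+1 x + flat k.+2 x = 0.
    by rewrite /flat !ltNge !(ltW x0)/= mulr0 addr0.
  apply: (near_eq_is_derive _ (is_derive_cst 0 x 1)).
  near=> y; rewrite /flat ifF//; apply/negbTE; rewrite -leNgt ltW//.
  by near: y; exact: lt_nbhsl.
- have H : is_derive x 1 (fun y : R => y^-1 ^+ k * expR (- y^-1))
     (- k%:R * flat k.+1 x + flat k.+2 x).
    have xn : x != 0 by rewrite gt_eqF.
    have dV : is_derive x 1 (fun y : R => y^-1) (- x ^- 2 *: 1).
      exact: (is_deriveV xn (is_derive_id x 1)).
    have dN : is_derive x 1 (fun y : R => - y^-1) (- (- x ^- 2 *: 1)).
      exact: is_deriveN dV.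
    have dE : is_derive x 1 (fun y : R => expR (- y^-1)) (expR (- x^-1) * - (- x ^- 2 *: 1)).
      exact: (@is_derive1_comp _ expR (fun y : R => - y^-1) x _ _ (is_derive_expR _) dN).
    have dX : is_derive x 1 (fun y : R => y^-1 ^+ k) ((k%:R * x^-1 ^+ k.-1) *: (- x ^- 2 *: 1)).
      by have := is_deriveX k dV; rewrite exprfctE.
    apply: (is_derive_eq (is_deriveM dX dE)); rewrite /flat x0 /GRing.scale/=.
    case: k {dX} => [|k].
      by rewrite !expr0 !mul0r mulr0 addr0 oppr0 mul0r add0r exprVn; ring.
    rewrite /= ![x^-1 ^+ _.+1]exprS -exprVn expr2; ring.
  apply: near_eq_is_derive H; near=> y; rewrite /flat ifT//.
  by near: y; exact: lt_nbhsr.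
have -> : - k%:R * flat k.+1 0 + flat k.+2 0 = 0.
  by rewrite /flat ltxx mulr0 addr0.
have [C C0 HC] := flat_quadratic k.
have f0 : flat k 0 = 0 by rewrite /flat ltxx.
have cv : (fun h : R => h^-1 *: (flat k (h *: 1 + 0) - flat k 0)) @ 0^' --> (0 : R).
  apply/cvgrPdist_lt => e e0.
  exists (e / (C + 1)) => /=; first by rewrite divr_gt0// ltr_wpDl.
  move=> h /=; rewrite sub0r normrN => hd h0.
  rewrite sub0r normrN f0 subr0 addr0 /GRing.scale/= mulr1 normrM normfV.
  rewrite mulrC ltr_pdivrMr ?normr_gt0//; apply: le_lt_trans (HC h) _.
  rewrite -[h ^+ 2]ger0_norm ?sqr_ge0// normrX expr2 mulrA ltr_pM2r ?normr_gt0//.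
  move: hd; rewrite ltr_pdivlMr ?ltr_wpDl//; apply: le_lt_trans.
  by rewrite mulrC ler_wpM2l// lerDl.
apply: DeriveDef; first by apply/cvg_ex; exists 0.
by rewrite /derive; apply: cvg_lim.
Unshelve. all: by end_near. Qed.

(* A class of functions closed under differentiation, hence made of smooth functions. *)
Inductive elem : (R -> R) -> Prop :=
| elem_flat k : elem (flat k)
| elem_cst c : elem (fun=> c)
| elem_add F G : elem F -> elem G -> elem (fun x => F x + G x)
| elem_mul F G : elem F -> elem G -> elem (fun x => F x * G x)
| elem_affine F c d : elem F -> elem (fun x => F (c * x + d))
| elem_inv F : elem F -> (forall x, F x != 0) -> elem (fun x => (F x)^-1).

Lemma elem_is_derive F : elem F ->
  exists2 G, elem G & forall x : R, is_derive x 1 F (G x).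
Proof.
elim => [k|c|F1 F2 e1 [G1 g1 d1] e2 [G2 g2 d2]|F1 F2 e1 [G1 g1 d1] e2 [G2 g2 d2]|
  F1 c d e1 [G1 g1 d1]|F1 e1 [G1 g1 d1] F0].
- exists (fun x => - k%:R * flat k.+1 x + flat k.+2 x); last exact: flat_is_derive.
  apply: elem_add; last exact: elem_flat.
  by apply: elem_mul; [exact: elem_cst|exact: elem_flat].
- by exists (fun=> 0); [exact: elem_cst|move=> x; exact: is_derive_cst].
- exists (fun x => G1 x + G2 x); first exact: elem_add.
  by move=> x; exact: is_deriveD (d1 x) (d2 x).
- exists (fun x => F1 x * G2 x + F2 x * G1 x).
    by apply: elem_add; exact: elem_mul.
  by move=> x; exact: is_deriveM (d1 x) (d2 x).
- exists (fun x => G1 (c * x + d) * c).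
    by apply: elem_mul; [exact: elem_affine|exact: elem_cst].
  move=> x; apply: (@is_derive1_comp _ F1 (fun y : R => c * y + d)) => //.
  apply: (is_derive_eq (is_deriveD (is_deriveZ c (is_derive_id x 1)) (is_derive_cst d x 1))).
  by rewrite /GRing.scale/= mulr1 addr0.
exists (fun x => (-1) * ((F1 x)^-1 * (F1 x)^-1) * G1 x).
  apply: elem_mul => //; apply: elem_mul; first exact: elem_cst.
  by apply: elem_mul; exact: elem_inv.
move=> x; apply: (is_derive_eq (is_deriveV (F0 x) (d1 x))).
rewrite /GRing.scale/= expr2 invfM; ring.
Qed.

Lemma elem_derivable_n F : elem F -> forall n (x : R), derivable (derive1n n F) x 1.
Proof.
move=> eF n; suff : elem (derive1n n F).
  by move=> /elem_is_derive[G _ dG] x; have [] := dG x.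
elim: n => [//|n /elem_is_derive[G eG dG]].
suff -> : derive1n n.+1 F = G by [].
apply/funext => x; have [_ <-] := dG x.
by rewrite /derive1n iterS derive1E.
Qed.

Lemma elem_continuous F : elem F -> continuous F.
Proof.
move=> /elem_is_derive[G _ dG] x; apply: differentiable_continuous.
by apply/derivable1_diffP; have [] := dG x.
Qed.

Definition smooth_step (x : R) : R := flat 0 x / (flat 0 x + flat 0 (1 - x)).

Lemma smooth_step_den_gt0 (x : R) : 0 < flat 0 x + flat 0 (1 - x).
Proof.
have [x0|x0] := ltP 0 x.
  by rewrite ltr_pwDl// ?flat_ge0// /flat x0 expr0 mul1r expR_gt0.
have x1 : 0 < 1 - x by lra.
by rewrite ltr_wpDl// ?flat_ge0// /flat x1 expr0 mul1r expR_gt0.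
Qed.

Lemma elem_smooth_step : elem smooth_step.
Proof.
have e1 : elem (fun x => flat 0 (1 - x)).
  have := elem_affine (-1) 1 (elem_flat 0); congr elem.
  by apply/funext => x; rewrite mulN1r addrC.
apply: elem_mul; first exact: elem_flat.
apply: elem_inv; first by apply: elem_add => //; exact: elem_flat.
by move=> x; rewrite gt_eqF// smooth_step_den_gt0.
Qed.

Lemma smooth_step0 (x : R) : x <= 0 -> smooth_step x = 0.
Proof. by move=> x0; rewrite /smooth_step /flat ltNge x0/= mul0r. Qed.

Lemma smooth_step1 (x : R) : 1 <= x -> smooth_step x = 1.
Proof.
move=> x1; have := smooth_step_den_gt0 x; rewrite /smooth_step.
have -> : flat 0 (1 - x) = 0 by rewrite /flat ifF// ltNge subr_le0 x1.
by rewrite addr0 => h; rewrite divff// gt_eqF.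
Qed.

Lemma smooth_step01 (x : R) : 0 <= smooth_step x <= 1.
Proof.
have h := smooth_step_den_gt0 x; rewrite /smooth_step.
apply/andP; split; first by apply: divr_ge0 (ltW h); exact: flat_ge0.
by rewrite ler_pdivrMr// mul1r lerDl flat_ge0.
Qed.

(** Outside [[0, 1]] the step is locally constant and its derivative vanishes; on [[0, 1]] the
    derivative is continuous, hence bounded. *)
Lemma smooth_step_derive : exists (G : R -> R) (B : R),
  [/\ elem G, forall x : R, is_derive x 1 smooth_step (G x),
      forall x, `|G x| <= B & forall x, G x != 0 -> 0 <= x <= 1].
Proof.
have [G eG dG] := elem_is_derive elem_smooth_step.
have G0 (x : R) : G x != 0 -> 0 <= x <= 1.
  move=> Gx; have uniq_ (c : R) : (\forall y \near x, c = smooth_step y) -> False.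
    move=> nc; have H := near_eq_is_derive nc (is_derive_cst c x 1).
    have [_ h1] := H; have [_ h2] := dG x; move: Gx.
    by rewrite -h2 h1 eqxx.
  apply/andP; split; rewrite leNgt; apply/negP => x0.
    apply: (uniq_ 0); near=> y; rewrite smooth_step0// ltW//.
    by near: y; exact: lt_nbhsl.
  apply: (uniq_ 1); near=> y; rewrite smooth_step1// ltW//.
  by near: y; exact: lt_nbhsr.
have [B HB] := @compact_continuous_bounded R _ G `[0, 1]%classic (@segment_compact _ 0 1)
  (fun x _ => elem_continuous eG (x := x)).
exists G, (Num.max 0 B); split => // x.
have [->|Gx] := eqVneq (G x) 0; first by rewrite normr0 le_max lexx.
by rewrite le_max HB ?orbT//= in_itv/= G0.
Unshelve. all: by end_near. Qed.

End elementary_smooth_functions.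

(** * Absolutely continuous representatives *)

Section absolutely_continuous_representative.
Context {R : realType}.
Local Notation mu := (@lebesgue_measure R).

Lemma primitive_on_FTC a b (F G : R -> R) : (forall x : R, is_derive x 1 F (G x)) ->
  continuous G -> primitive_on a b F G.
Proof.
move=> dF cG; have cGW (x y : R) : {within `[x, y], continuous G}.
  by apply: continuous_subspaceT.
have cF : continuous F.
  move=> x; apply: differentiable_continuous.
  by apply/derivable1_diffP; have [] := dF x.
split; first exact: within_integrable_itvoc.
move=> x y _ + _; rewrite le_eqVlt => /predU1P[->|xy].
  by rewrite subrr set_itv_ge ?bnd_simp ?ltxx// Rintegral_set0.
rewrite Rintegral_itv_obnd_cbnd; last exact: within_integrable_itvoc.
rewrite /Rintegral (@continuous_FTC2 _ G F x y)//.
  split.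
  - by move=> z _; have [] := dF z.
  - by apply: cvg_at_right_filter; exact: cF.
  - by apply: cvg_at_left_filter; exact: cF.
by move=> z _; rewrite derive1E; have [] := dF z.
Qed.

Lemma Rintegral_zero_outside a b x y (F : R -> R) : a <= x -> x <= y -> y <= b ->
  mu.-integrable `]a, b] (EFin \o F) ->
  (forall t, a < t <= b -> ~~ (x < t <= y) -> F t = 0) ->
  \int[mu]_(t in `]a, b]) F t = \int[mu]_(t in `]x, y]) F t.
Proof.
move=> ax xy yb Fi F0.
rewrite (Rintegral_itvoc_cat ax (le_trans xy yb) Fi).
rewrite (Rintegral_itvoc_cat xy yb); last exact: integrable_itvoc_sub Fi.
have z (s t : R) : (forall r, s < r <= t -> F r = 0) -> \int[mu]_(r in `]s, t]) F r = 0.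
  move=> H; rewrite (@eq_Rintegral _ _ _ _ _ (cst 0)).
    by rewrite Rintegral_cst// mul0r.
  by move=> r; rewrite inE/= in_itv/= => /H.
rewrite [X in X + _]z ?[X in _ + (_ + X)]z ?addr0 ?add0r//.
  move=> r /andP[yr rb]; apply: F0.
    by rewrite rb (le_lt_trans ax (le_lt_trans xy yr)).
  by rewrite [r <= y]leNgt yr andbF.
move=> r /andP[ar rx]; apply: F0.
  by rewrite ar (le_trans rx (le_trans xy yb)).
by rewrite [x < r]ltNge rx.
Qed.

Lemma lebesgue_pt_dist (u : R -> R) (p : R) : lebesgue_pt u p ->
  forall e : R, 0 < e -> exists2 r0 : R, 0 < r0 & forall r : R, 0 < r < r0 ->
  (\int[mu]_(y in ball p r) `|u y - u p|%:E <= (e * (2 * r))%:E)%E.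
Proof.
move=> /fine_cvgP[[r1 /= r10 H1] /cvgrPdist_le H2] e e0.
have [r2 /= r20 {}H2] := H2 _ e0.
exists (Num.min r1 r2); first by rewrite lt_min r10.
move=> r /andP[r0]; rewrite lt_min => /andP[rr1 rr2].
have b1 : `|0 - r| < r1 by rewrite sub0r normrN gtr0_norm.
have b2 : `|0 - r| < r2 by rewrite sub0r normrN gtr0_norm.
have fn := H1 r b1 r0; have := H2 r b2 r0.
rewrite /= sub0r normrN => /(le_trans (ler_norm _)).
rewrite -lee_fin fineK// /davg /iavg lebesgue_measure_ball ?(ltW r0)//.
rewrite inver mulrn_eq0/= (gt_eqF r0)/=.
rewrite lee_pdivrMl; last by rewrite pmulrn_lgt0.
by rewrite -EFinM -[r *+ 2]mulr_natl [e * _]mulrC.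
Qed.

Lemma smooth_step_scaled_derive (G : R -> R) (r h x : R) :
  (forall x : R, is_derive x 1 smooth_step (G x)) ->
  is_derive x 1 (fun x : R => smooth_step ((x - r) / h)) (h^-1 * G ((x - r) / h)).
Proof.
move=> dG; have dA : is_derive x 1 (fun x : R => (x - r) / h) h^-1.
  apply: (is_derive_eq (is_deriveM
    (is_deriveB (is_derive_id x 1) (is_derive_cst r x 1)) (is_derive_cst h^-1 x 1))).
  by rewrite scaler0 add0r subr0 /GRing.scale/= mulr1.
have := @is_derive1_comp _ smooth_step (fun x : R => (x - r) / h) x _ _ (dG _) dA.
by rewrite mulrC.
Qed.

Lemma scaled_continuous (G : R -> R) (r h : R) : continuous G ->
  continuous (fun x : R => h^-1 * G ((x - r) / h)).
Proof.
move=> cG x; apply: cvgM; first exact: cvg_cst.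
have cA : {for x, continuous (fun x : R => (x - r) / h)}.
  by apply: cvgM; [apply: cvgB; [exact: cvg_id|exact: cvg_cst]|exact: cvg_cst].
exact: (@continuous_comp _ _ _ (fun x : R => (x - r) / h) G x cA (cG _)).
Qed.

(** The kernel is the derivative of a rescaled step: it has mass [1], lives in [[p, p + h]] and is
    bounded by [B / h]. The error is thus controlled by a mean of [|u - u p|], small at a Lebesgue
    point. *)
Lemma mollify_lebesgue_pt a b (u : R -> R) (p B : R) (G : R -> R) :
  mu.-integrable `[a, b] (EFin \o u) -> a < p < b ->
  lebesgue_pt (u \_ `[a, b]) p -> continuous G ->
  (forall x : R, is_derive x 1 smooth_step (G x)) ->
  (forall x, `|G x| <= B) -> (forall x, G x != 0 -> 0 <= x <= 1) ->
  forall e : R, 0 < e -> exists2 h0 : R, 0 < h0 & forall h : R, 0 < h < h0 ->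
  `|\int[mu]_(x in `]a, b]) (h^-1 * G ((x - p) / h) * u x) - u p| <= e.
Proof.
move=> ui /andP[ap pb] Lp cG dG GB G0 e e0.
have B0 : 0 <= B by apply: le_trans (GB 0).
(* The final bound is [B / h] times [e / (4 * B + 1)] times [4 * h], at most [e]. *)
have e10 : 0 < e / (4 * B + 1) by rewrite divr_gt0// ltr_wpDl// mulr_ge0.
have [r0 r00 Hr] := lebesgue_pt_dist Lp e10.
(* Halves, because the open ball of radius [2 * h] is used: it contains []p - h, p + h]] with its
   right end, and stays inside [[a, b]], where [u] agrees with its restriction. *)
exists (Num.min (r0 / 2) (Num.min ((p - a) / 2) ((b - p) / 2))).
  by rewrite !lt_min !divr_gt0// subr_gt0.
move=> h /andP[h0]; rewrite !lt_min => /andP[hr /andP[ha hb]].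
have uio : mu.-integrable `]a, b] (EFin \o u).
  by apply: integrableS ui => //; exact: subset_itv_oc_cc.
pose rho x := h^-1 * G ((x - p) / h).
have hi0 : 0 < h^-1 by rewrite invr_gt0.
have crho : continuous rho by exact: scaled_continuous.
have prim : primitive_on a b (fun x => smooth_step ((x - p) / h)) rho.
  by apply: primitive_on_FTC => // x; exact: smooth_step_scaled_derive.
have rhoB x : `|rho x| <= h^-1 * B.
  by rewrite normrM (gtr0_norm hi0) ler_wpM2l// ltW.
have mrho : measurable_fun `]a, b] rho.
  by apply: within_measurable_itvoc; exact: continuous_subspaceT.
have int1 : \int[mu]_(x in `]a, b]) rho x = 1.
  have [_ /(_ a b (lexx a) (ltW (lt_trans ap pb)) (lexx b)) <-] := prim.
  rewrite smooth_step1 ?smooth_step0 ?subr0//.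
    by rewrite pmulr_lle0// subr_le0 ltW.
  rewrite ler_pdivlMr// mul1r; lra.
have rhoi : mu.-integrable `]a, b] (EFin \o rho) by have [] := prim.
have rui : mu.-integrable `]a, b] (EFin \o (fun x => rho x * u x)).
  by apply: (@integrable_itvoc_bddM _ _ _ _ _ (h^-1 * B)).
have rupi := integrable_scale (u p) (measurable_itv `]a, b]) rhoi.
have -> : u p = \int[mu]_(x in `]a, b]) (u p * rho x).
  by rewrite RintegralZl// int1 mulr1.
rewrite -RintegralB//.
have di := integrable_minus (measurable_itv _) rui rupi.
have x1 : a <= p - h by lra.
have x2 : p - h <= p + h by lra.
have x3 : p + h <= b by lra.
rewrite (Rintegral_zero_outside x1 x2 x3 di); last first.
  move=> t _ tph; have [rt|] := eqVneq (rho t) 0; first by rewrite -/(rho t) rt mul0r mulr0 subr0.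
  rewrite /rho mulf_eq0 negb_or => /andP[_ /G0].
  rewrite ler_pdivlMr// mul0r ler_pdivrMr// mul1r => /andP[t1 t2].
  by move: tph; rewrite negb_and -ltNge -leNgt => /orP[]; lra.
have ui' := integrable_itvoc_sub x1 x3 uio.
have ci : mu.-integrable `]p - h, p + h] (EFin \o cst (u p)).
  by apply: (@bounded_integrable_itvoc _ _ _ _ `|u p|).
have adi := integrable_abs (integrable_minus (measurable_itv _) ui' ci).
apply: (@le_trans _ _ (h^-1 * B * \int[mu]_(x in `]p - h, p + h]) `|u x - u p|)).
  rewrite -RintegralZl//; apply: Rintegral_abs_le => //.
  - exact: integrable_itvoc_sub di.
  - exact: (integrable_scale (h^-1 * B) (measurable_itv _) adi).
  move=> x _; rewrite -/(rho x) [u p * _]mulrC -mulrBr normrM.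
  by apply: ler_wpM2r => //; exact: rhoB.
have hr2 : 0 < 2 * h < r0 by rewrite mulr_gt0//=; lra.
have D : \int[mu]_(x in `]p - h, p + h]) `|u x - u p| <= e / (4 * B + 1) * (4 * h).
  have H : (\int[mu]_(x in `](p - h)%R, (p + h)%R]) `|u x - u p|%:E <=
      (e / (4 * B + 1) * (4 * h))%:E)%E.
    have -> : 4 * h = 2 * (2 * h) by ring.
    apply: le_trans (Hr _ hr2).
    have upE y : a <= y <= b -> (u \_ `[a, b]) y = u y.
      by move=> yab; rewrite patchE mem_set//= in_itv.
    rewrite upE ?(ltW ap) ?(ltW pb)//.
    have sub : `]p - h, p + h] `<=` ball p (2 * h).
      move=> y; rewrite /= in_itv/= /ball/= => /andP[y1 y2].
      rewrite ltr_norml; apply/andP; split; lra.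
    have subab y : ball p (2 * h) y -> a <= y <= b.
      by rewrite /ball/= ltr_norml => /andP[y1 y2]; apply/andP; split; lra.
    have mb : measurable (ball p (2 * h)) by exact: measurable_ball.
    have E : (\int[mu]_(y in ball p (2 * h)) `|(u \_ `[a, b]) y - u p|%:E =
       \int[mu]_(y in ball p (2 * h)) `|u y - u p|%:E)%E.
      by apply: eq_integral => y; rewrite inE => yb; rewrite (upE _ (subab y yb)).
    rewrite E; apply: ge0_subset_integral => //.
    have mu1 : measurable_fun (ball p (2 * h)) u.
      have mu0 : measurable_fun `[a, b] u by move/(measurable_int mu)/measurable_EFinP : ui.
      have sb : ball p (2 * h) `<=` `[a, b].
        by move=> y yb; have := subab y yb; rewrite /= in_itv.
      exact: (measurable_funS (measurable_itv _) sb mu0).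
    apply/measurable_EFinP; apply: measurableT_comp => //.
    exact: (measurable_funB mu1 (measurable_cst _)).
  rewrite /Rintegral -lee_fin fineK//; exact: (integrable_fin_num _ adi).
apply: (@le_trans _ _ (h^-1 * B * (e / (4 * B + 1) * (4 * h)))).
  by apply: ler_wpM2l D; rewrite mulr_ge0// ltW.
have -> : h^-1 * B * (e / (4 * B + 1) * (4 * h)) = e * ((4 * B) / (4 * B + 1)).
  field; rewrite (gt_eqF h0)/=; lra.
rewrite -[leRHS]mulr1 ler_wpM2l ?(ltW e0)// ler_pdivrMr; lra.
Qed.

Lemma integral_zero_outside (A E : set R) (F : R -> \bar R) : E `<=` A ->
  (forall x, A x -> ~ E x -> F x = 0%E) ->
  (\int[mu]_(x in A) F x = \int[mu]_(x in E) F x)%E.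
Proof.
move=> EA F0; rewrite integral_mkcond [RHS]integral_mkcond.
congr (integral _ _ _); apply/funext => x; rewrite !patchE.
have [xE|xE] := boolP (x \in E).
  by rewrite ifT//; apply/mem_set/EA/set_mem.
case: ifP => // /set_mem xA; apply: F0 => //.
by move/mem_set; rewrite (negbTE xE).
Qed.

(** A step at [p] minus a step at [q]: the derivative is a mollifier at [p] minus one at [q], so
    that testing it against [u] approximates [u p - u q]. With [h < q - p] the first step ends
    before the second begins. *)
Lemma smooth_bump (p q h : R) (G : R -> R) : p < q -> 0 < h -> h < q - p ->
  (forall x : R, is_derive x 1 smooth_step (G x)) ->
  exists phi : R -> R, [/\ forall (n : nat) (x : R), derivable (derive1n n phi) x 1,
    forall x, derive1 phi x = h^-1 * G ((x - p) / h) - h^-1 * G ((x - q) / h),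
    forall x, 0 <= phi x <= 1,
    forall x, p + h <= x <= q -> phi x = 1 &
    forall x, ~~ (p < x <= q + h) -> phi x = 0].
Proof.
move=> pq h0 hpq dG.
pose S r x := smooth_step ((x - r) / h).
have eS r : elem (S r).
  have := elem_affine h^-1 (- r / h) elem_smooth_step; congr elem.
  by apply/funext => x; rewrite /S; congr smooth_step; ring.
exists (fun x => S p x - S q x).
have S1 r x : r + h <= x -> S r x = 1.
  by move=> rx; apply: smooth_step1; rewrite ler_pdivlMr// mul1r; lra.
have S0 r x : x <= r -> S r x = 0.
  by move=> xr; apply: smooth_step0; rewrite pmulr_lle0 ?invr_gt0// subr_le0.
split.
- apply: elem_derivable_n.
  have := elem_add (eS p) (elem_mul (elem_cst (-1)) (eS q)); congr elem.
  by apply/funext => x; rewrite mulN1r.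
- move=> x; have dA r : is_derive x 1 (S r) (h^-1 * G ((x - r) / h)).
    exact: smooth_step_scaled_derive.
  by have [_ <-] := is_deriveB (dA p) (dA q); rewrite derive1E.
- move=> x; have /andP[p0 p1] := smooth_step01 ((x - p) / h).
  have /andP[q0 q1] := smooth_step01 ((x - q) / h).
  have [xq|qx] := leP x q; first by rewrite (S0 q)// subr0 /S p0.
  by rewrite (S1 p)/= ?subr_ge0 ?lerBlDr ?lerDl ?/(S q x) ?q0 ?q1//; lra.
- by move=> x /andP[px xq]; rewrite (S1 p)// (S0 q)// subr0.
move=> x; rewrite negb_and -leNgt -ltNge => /orP[xp|xq].
  by rewrite !S0 ?subrr//; lra.
by rewrite !S1 ?subrr//; lra.
Qed.

(** The bump is inserted in the weak derivative identity. One side tends to [u p - u q] at Lebesgue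
    points; the other tends to minus the integral of [du] over []p, q]], since the bump differs from
    the indicator only on strips of width [h] to the right of [p] and of [q]. *)
Lemma W11loc_increment (Omega : set R) (u du : R -> R) a b p q :
  W11loc_with_deriv Omega u du -> `[a, b] `<=` Omega -> a < p -> p < q -> q < b ->
  lebesgue_pt (u \_ `[a, b]) p -> lebesgue_pt (u \_ `[a, b]) q ->
  u q - u p = \int[mu]_(x in `]p, q]) du x.
Proof.
move=> [ui dui weak] abO ap pq qb Lp Lq.
have {}ui : mu.-integrable `[a, b] (EFin \o u) by exact: (ui _ (@segment_compact _ a b) abO).
have {}dui : mu.-integrable `[a, b] (EFin \o du) by exact: (dui _ (@segment_compact _ a b) abO).
have uio : mu.-integrable `]a, b] (EFin \o u).
  by apply: integrableS ui => //; exact: subset_itv_oc_cc.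
have duio : mu.-integrable `]a, b] (EFin \o du).
  by apply: integrableS dui => //; exact: subset_itv_oc_cc.
have [G [B [eG dG GB G0]]] := @smooth_step_derive R.
have cG := elem_continuous eG.
apply/eqP; rewrite -subr_eq0 -normr_eq0 eq_le normr_ge0 andbT.
apply/ler_addgt0Pr => e e0; rewrite add0r.
(* One quarter for each mollified value and each strip. *)
have e4 : 0 < e / 4 by rewrite divr_gt0.
have pab : a < p < b by rewrite ap (lt_trans pq qb).
have qab : a < q < b by rewrite qb (lt_trans ap pq).
have [h1 h10 H1] := mollify_lebesgue_pt ui pab Lp cG dG GB G0 e4.
have [h2 h20 H2] := mollify_lebesgue_pt ui qab Lq cG dG GB G0 e4.
have adui := integrable_abs duio.
have [d d0 Hd] := primitive_on_unif (primitive_on_integral 0 adui) e4.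
have [_ dprim] := primitive_on_integral 0 adui.
(* [d] makes the strips negligible, [q - p] separates the two steps, and [b - q] keeps the support
   of the bump inside []a, b]]. *)
pose m := Num.min (Num.min h1 h2) (Num.min d (Num.min (q - p) (b - q))).
have m0 : 0 < m by rewrite !lt_min h10 h20 d0 !subr_gt0 pq qb.
pose h := m / 2.
have h0 : 0 < h by rewrite divr_gt0.
have : h < m by rewrite /h; lra.
rewrite !lt_min => /andP[/andP[hh1 hh2] /andP[hd /andP[hpq hqb]]].
have {}H1 := H1 h; have {}H2 := H2 h; rewrite h0 hh1 hh2 in H1 H2.
have {}H1 := H1 isT; have {}H2 := H2 isT.
have [phi [phiS dphi phi01 phi1 phi0]] := smooth_bump pq h0 hpq dG.
have sub : `]a, b] `<=` Omega by move=> x /subset_itv_oc_cc; exact: abO.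
have qhb : q + h <= b by rewrite -lerBrDl ltW.
have dphi0 x : ~ `]a, b]%classic x -> derive1 phi x = 0.
  move=> nx; have G00 r : p <= r <= q -> G ((x - r) / h) = 0.
    move=> /andP[pr rq]; apply/eqP/negP => /negP/G0.
    rewrite ler_pdivlMr// mul0r ler_pdivrMr// mul1r subr_ge0 lerBlDl => /andP[t1 t2].
    apply: nx; rewrite /= in_itv/= (lt_le_trans ap (le_trans pr t1))/=.
    exact: le_trans t2 (le_trans (lerD rq (lexx h)) qhb).
  by rewrite dphi !G00 ?mulr0 ?subrr// lexx ltW.
have phi0' x : ~ `]a, b]%classic x -> phi x = 0.
  move=> nx; apply: phi0; apply/negP => /andP[x1 x2].
  by apply: nx; rewrite /= in_itv/= (lt_trans ap x1) (le_trans x2 qhb).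
have tphi : test_fun Omega phi.
  split => //; exists `[a, b]%classic; split => //; first exact: segment_compact.
  by move=> x nx; apply: phi0' => /subset_itv_oc_cc.
have := weak phi tphi.
rewrite (integral_zero_outside (A := Omega) sub); last first.
  by move=> x _ nx; rewrite dphi0// mulr0.
rewrite (integral_zero_outside (A := Omega) sub); last first.
  by move=> x _ nx; rewrite phi0'// mulr0.
have cphi : continuous phi.
  move=> x; apply: differentiable_continuous; apply/derivable1_diffP.
  exact: (phiS 0%N x).
have mphi : measurable_fun `]a, b] phi.
  by apply: within_measurable_itvoc; exact: continuous_subspaceT.
have dupi : mu.-integrable `]a, b] (EFin \o (fun x => phi x * du x)).
  apply: (@integrable_itvoc_bddM _ _ _ _ _ 1) => // x _.
  by have /andP[? ?] := phi01 x; rewrite ger0_norm.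
have hi0 : 0 < h^-1 by rewrite invr_gt0.
have moli r : mu.-integrable `]a, b] (EFin \o (fun x => h^-1 * G ((x - r) / h) * u x)).
  apply: (@integrable_itvoc_bddM _ _ _ _ _ (h^-1 * B)) => //.
    apply: within_measurable_itvoc; apply: continuous_subspaceT.
    exact: scaled_continuous.
  by move=> x _; rewrite normrM (gtr0_norm hi0) ler_wpM2l// ltW.
move=> /(congr1 fine); rewrite fineN => eqn.
have {}eqn : \int[mu]_(x in `]a, b]) (h^-1 * G ((x - p) / h) * u x) -
   \int[mu]_(x in `]a, b]) (h^-1 * G ((x - q) / h) * u x) =
   - \int[mu]_(x in `]a, b]) (phi x * du x).
  rewrite -RintegralB//; transitivity (\int[mu]_(x in `]a, b]) (u x * derive1 phi x)).
    by apply: eq_Rintegral => x _; rewrite dphi; ring.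
  rewrite [LHS]eqn; congr (- _).
  by apply: eq_Rintegral => x _; rewrite mulrC.
have small x y (w : R -> R) : a <= x -> x <= y -> y <= b -> y - x < d ->
    mu.-integrable `]x, y] (EFin \o (fun t => w t * du t)) ->
    (forall t, `|w t| <= 1) -> `|\int[mu]_(t in `]x, y]) (w t * du t)| <= e / 4.
  move=> ax xy yb yxd wi w1.
  have := Hd y x; rewrite ax yb (le_trans ax xy) (le_trans xy yb) => /(_ isT isT).
  have yx : `|y - x| < d by rewrite ger0_norm ?subr_ge0.
  move=> /(_ yx); rewrite (dprim x y ax xy yb).
  move=> h3; apply: le_trans (ltW h3); apply: le_trans (ler_norm _).
  apply: Rintegral_abs_le => //; first exact: integrable_itvoc_sub adui.
  by move=> t _; rewrite normrM ler_piMl.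
have part : `|\int[mu]_(x in `]a, b]) (phi x * du x) - \int[mu]_(x in `]p, q]) du x| <=
    e / 4 + e / 4.
  have dui_pq := integrable_itvoc_sub (ltW ap) (ltW qb) duio.
  have dupi_pq := integrable_itvoc_sub (ltW ap) (ltW qb) dupi.
  have y1 : p <= q + h by rewrite (le_trans (ltW pq))// lerDl ltW.
  have y3 : q <= q + h by rewrite lerDl ltW.
  rewrite (Rintegral_zero_outside (ltW ap) y1 qhb dupi); last first.
    by move=> t _ nt; rewrite phi0// mul0r.
  rewrite (Rintegral_itvoc_cat (ltW pq) y3); last exact: integrable_itvoc_sub (ltW ap) qhb dupi.
  rewrite addrAC -RintegralB//.
  have ei : mu.-integrable `]p, q] (EFin \o (fun x => (phi x - 1) * du x)).
    have := integrable_minus (measurable_itv `]p, q]) dupi_pq dui_pq.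
    by apply: eq_integrable => // x _; rewrite /= mulrBl mul1r.
  have -> : \int[mu]_(x in `]p, q]) (phi x * du x - du x) =
     \int[mu]_(x in `]p, q]) ((phi x - 1) * du x).
    by apply: eq_Rintegral => x _; rewrite mulrBl mul1r.
  apply: le_trans (ler_normD _ _) _; apply: lerD; last first.
    have aq : a <= q by rewrite ltW// (lt_trans ap pq).
    apply: small => //; [by rewrite addrAC subrr add0r|exact: integrable_itvoc_sub aq qhb dupi|].
    by move=> t; have /andP[? ?] := phi01 t; rewrite ger0_norm.
  have y4 : p <= p + h by rewrite lerDl ltW.
  have y5 : p + h <= q by rewrite -lerBrDl ltW.
  rewrite (Rintegral_zero_outside (lexx p) y4 y5 ei); last first.
    move=> t /andP[pt tq] nt; rewrite phi1 ?subrr ?mul0r//.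
    by move: nt; rewrite pt/= -ltNge => /ltW ->.
  apply: small; [exact: ltW|exact: y4|exact: le_trans y5 (ltW qb)| | |].
    by rewrite addrAC subrr add0r.
    exact: integrable_itvoc_sub (lexx p) y5 ei.
  move=> t; have /andP[? ?] := phi01 t.
  by rewrite distrC ger0_norm ?subr_ge0// lerBlDr lerDl.
move: H1 H2 part eqn.
move: (\int[mu]_(x in `]a, b]) (h^-1 * G ((x - p) / h) * u x)) => X1.
move: (\int[mu]_(x in `]a, b]) (h^-1 * G ((x - q) / h) * u x)) => X2.
move: (\int[mu]_(x in `]a, b]) (phi x * du x)) => X3.
move: (\int[mu]_(x in `]p, q]) du x) => X4.
move: (u p) (u q) => X5 X6; clear.
rewrite !ler_norml => /andP[? ?] /andP[? ?] /andP[? ?] ?; apply/andP; split; lra.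
Qed.

(** Almost every point is a Lebesgue point. A primitive of [du] is normalized to agree with [u] at
    one of them, [p], and the increment formula extends the agreement to the others. *)
Lemma W11loc_representative (Omega : set R) (u du : R -> R) a b :
  W11loc_with_deriv Omega u du -> a < b -> `[a, b] `<=` Omega ->
  exists2 U : R -> R, primitive_on a b U du &
    {ae mu, forall x, `]a, b]%classic x -> u x = U x}.
Proof.
move=> W ab abO; have [ui dui _] := W.
have {}ui : mu.-integrable `[a, b] (EFin \o u) by exact: (ui _ (@segment_compact _ a b) abO).
have {}dui : mu.-integrable `[a, b] (EFin \o du) by exact: (dui _ (@segment_compact _ a b) abO).
have duio : mu.-integrable `]a, b] (EFin \o du).
  by apply: integrableS dui => //; exact: subset_itv_oc_cc.
have [N [mN N0 HN]] : {ae mu, forall x, lebesgue_pt (u \_ `[a, b]) x}.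
  apply: lebesgue_differentiation.
  exact: (integrable_locally_restrict (measurable_itv `[a, b]) ui).
have LN x : ~ N x -> lebesgue_pt (u \_ `[a, b]) x.
  by move=> Nx; apply: contrapT => nL; apply: Nx; exact: HN.
have [p [pab pN]] : exists p, a < p < b /\ ~ N p.
  apply: contrapT => H; have sub : `]a, b[ `<=` N.
    move=> x; rewrite /= in_itv/= => xab; apply: contrapT => Nx.
    by apply: H; exists x.
  have : (mu `]a, b[ <= 0)%E.
    by rewrite -N0; apply: le_measure; rewrite ?inE//; exact: measurable_itv.
  rewrite lebesgue_measure_itv/= lte_fin ab.
  by rewrite -EFinD lee_fin subr_le0 leNgt ab.
have [_ prim] := primitive_on_integral 0 duio.
exists (fun x => (u p - \int[mu]_(t in `]a, p]) du t) + \int[mu]_(t in `]a, x]) du t).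
  exact: primitive_on_integral.
(* The increment formula is for interior points, while [b] belongs to []a, b]]; it joins the null
   set. *)
exists (N `|` [set b]); split.
- exact: measurableU.
- by rewrite null_set_setU//; exact: lebesgue_measure_set1.
move=> x /= nx; have [->|xb] := eqVneq x b; first by right.
left; apply: contrapT => Nx; apply: nx; rewrite in_itv/= => /andP[ax xb'].
have {}xb : x < b by rewrite lt_neqAle xb.
have /andP[ap pb] := pab.
have := prim p x; have := prim x p.
rewrite !add0r => P1 P2.
have [xp|px|->] := ltgtP x p.
- have := W11loc_increment W abO ax xp pb (LN _ Nx) (LN _ pN).
  rewrite -P1 ?ltW//; lra.
- have := W11loc_increment W abO ap px xb (LN _ pN) (LN _ Nx).
  rewrite -P2 ?ltW//; lra.
by rewrite subrK.
Qed.

End absolutely_continuous_representative.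

(** * Exhaustion of the domain *)

Section localization.
Context {R : realType} (Omega : set R) (f : R -> R -> R -> R).
Local Notation mu := (@lebesgue_measure R).
Hypothesis hOmega : open Omega.
Hypothesis hpos : forall x s xi, Omega x -> 0 <= f x s xi.
Hypothesis hcontp : forall p : R * R * R, Omega p.1.1 ->
  {for p, continuous (fun p : R * R * R => f p.1.1 p.1.2 p.2)}.
Hypothesis hint : forall a b (u w : R -> R), `[a, b] `<=` Omega -> primitive_on a b u w ->
  mu.-integrable `]a, b] (EFin \o (fun x => f x (u x) (w x))).
Hypothesis hbound : forall a b (U W : R -> R), a < b -> `[a, b] `<=` Omega ->
  primitive_on a b U W ->
  forall e : R, 0 < e -> exists2 C : R, 0 <= C &
  forall V Z, primitive_on a b V Z ->
  \int[mu]_(x in `]a, b]) f x (U x) (W x) <=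
  \int[mu]_(x in `]a, b]) f x (V x) (Z x) + e +
  C * \int[mu]_(x in `]a, b]) `|V x - U x|.

Lemma ae_mono2 (P Q S : R -> Prop) : (forall x, P x -> Q x -> S x) ->
  {ae mu, forall x, P x} -> {ae mu, forall x, Q x} -> {ae mu, forall x, S x}.
Proof.
move=> PQS [N [mN N0 HN]] [M [mM M0 HM]]; exists (N `|` M); split.
- exact: measurableU.
- by rewrite null_set_setU.
move=> x /= nS; have [Px|nP] := pselect (P x); last by left; exact: HN.
by right; apply: HM => /= Qx; apply: nS; exact: PQS.
Qed.

Lemma loc_integrable_measurable (v : R -> R) a b : loc_integrable Omega v ->
  `[a, b] `<=` Omega -> measurable_fun `]a, b] v.
Proof.
move=> vi abO; have := vi _ (@segment_compact _ a b) abO.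
move=> /(measurable_int mu)/measurable_EFinP; apply: measurable_funS => //.
exact: subset_itv_oc_cc.
Qed.

(** Passing to the representative turns the extended integral into a real one, finite by [hint]. *)
Lemma energy_representative (v dv : R -> R) a b : W11loc_with_deriv Omega v dv ->
  a < b -> `[a, b] `<=` Omega ->
  exists V : R -> R, [/\ primitive_on a b V dv,
    {ae mu, forall x, `]a, b]%classic x -> v x = V x} &
    (\int[mu]_(x in `]a, b]) (f x (v x) (dv x))%:E =
     (\int[mu]_(x in `]a, b]) f x (V x) (dv x))%:E)%E].
Proof.
move=> W ab abO; have [vi dvi _] := W.
have [V VP vV] := W11loc_representative W ab abO; exists V; split => //.
have fi := hint abO VP.
have abO' : `]a, b] `<=` Omega by move=> x /subset_itv_oc_cc; exact: abO.
have mf (z : R -> R) : measurable_fun `]a, b] z ->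
    measurable_fun `]a, b] (fun x => f x (z x) (dv x)).
  move=> mz; apply: (@continuous_triple_measurable R `]a, b]%classic Omega) => //.
  exact: loc_integrable_measurable dvi abO.
have mv := mf _ (loc_integrable_measurable vi abO).
have mV := mf _ (within_measurable_itvoc (primitive_on_continuous VP)).
rewrite /Rintegral fineK; last exact: integrable_fin_num fi.
apply: ae_eq_integral => //; [exact/measurable_EFinP|exact/measurable_EFinP|].
by apply: (ae_mono2 _ vV vV) => x H _ xab; rewrite /= (H xab).
Qed.

Section sequence.
Context (um dum : nat -> R -> R) (u du : R -> R).
Hypothesis hum : forall m, W11loc_with_deriv Omega (um m) (dum m).
Hypothesis hu : W11loc_with_deriv Omega u du.
Hypothesis hcvg : cvg_L1loc Omega um u.

(** An eventual inequality with additive error is stable under finite disjoint unions: finitely many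
    eventual conditions hold together, and the errors add. *)
Definition lsc_on (D : set R) := forall e : R, 0 < e -> \forall m \near \oo,
  (\int[mu]_(x in D) (f x (u x) (du x))%:E <=
   \int[mu]_(x in D) (f x (um m x) (dum m x))%:E + e%:E)%E.

(** [C] depends on the limit and on [e] only, so L1 convergence on the compact [[a, b]] makes the
    last term of [hbound] at most [e / 2] for all large [m]. Representatives, equal almost
    everywhere, change neither energies nor distances. *)
Lemma lsc_on_itv a b : a < b -> `[a, b] `<=` Omega -> lsc_on `]a, b].
Proof.
move=> ab abO e e0.
have [U [UP uU ->]] := energy_representative hu ab abO.
have e20 : 0 < e / 2 by rewrite divr_gt0.
have [C C0 HC] := hbound ab abO UP e20.
have e30 : 0 < e / (2 * (C + 1)) by rewrite divr_gt0// mulr_gt0// ltr_wpDl.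
have /fine_cvgP[_ /cvgrPdist_le/(_ _ e30)] := hcvg (@segment_compact _ a b) abO.
apply: filterS => m /=; rewrite sub0r normrN => /(le_trans (ler_norm _)) Hm.
have [V [VP vV ->]] := energy_representative (hum m) ab abO.
rewrite -EFinD lee_fin; apply: le_trans (HC _ _ VP) _.
rewrite -addrA lerD2l.
have HD : \int[mu]_(x in `]a, b]) `|V x - U x| <= e / (2 * (C + 1)).
  have [umi _ _] := hum m; have [ui _ _] := hu.
  have ii : mu.-integrable `[a, b] (EFin \o (fun x => `|um m x - u x|)).
    apply: integrable_abs; apply: integrable_minus => //.
      exact: (umi _ (@segment_compact _ a b) abO).
    exact: (ui _ (@segment_compact _ a b) abO).
  have iio : mu.-integrable `]a, b] (EFin \o (fun x => `|um m x - u x|)).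
    by apply: integrableS ii => //; exact: subset_itv_oc_cc.
  have di := primitive_diff_integrable VP UP.
  apply: le_trans Hm; rewrite le_eqVlt; apply/orP; left; apply/eqP.
  transitivity (\int[mu]_(x in `]a, b]) `|um m x - u x|); last first.
    exact: Rintegral_itv_obnd_cbnd.
  congr fine; apply: ae_eq_integral => //; [exact: measurable_int di|exact: measurable_int iio|].
  by apply: (ae_mono2 _ vV uU) => x H1 H2 xab; rewrite /= (H1 xab) (H2 xab).
apply: (@le_trans _ _ (e / 2 + C * (e / (2 * (C + 1))))).
  by rewrite lerD2l ler_wpM2l.
have -> : C * (e / (2 * (C + 1))) = e / 2 * (C / (C + 1)) by field; lra.
have : e / 2 * (C / (C + 1)) <= e / 2.
  by rewrite -[leRHS]mulr1 ler_wpM2l ?(ltW e20)// ler_pdivrMr; lra.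
lra.
Qed.

Lemma lsc_on_set0 : lsc_on set0.
Proof.
by move=> e e0; near=> m; rewrite !integral_set0 add0e lee_fin ltW.
Unshelve. all: by end_near. Qed.

(** [loc_integrable] speaks of compact subsets only, so measurability on [D] is recorded as a
    clause; for [Omega] itself it is obtained by exhaustion. *)
Definition regular (D : set (measurableTypeR R)) := [/\ measurable D, D `<=` Omega &
  forall v : R -> R, loc_integrable Omega v -> measurable_fun D v].

Lemma energy_measurable D v dv : regular D -> W11loc_with_deriv Omega v dv ->
  measurable_fun D (fun x => (f x (v x) (dv x))%:E).
Proof.
move=> [mD DO mD'] [vi dvi _]; apply/measurable_EFinP.
by apply: (@continuous_triple_measurable R D Omega) => //; exact: mD'.
Qed.

Lemma lsc_on_setU (A B : set R) : regular A -> regular B -> [disjoint A & B] ->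
  regular (A `|` B) -> lsc_on A -> lsc_on B -> lsc_on (A `|` B).
Proof.
move=> rA rB AB rU lA lB e e0; have [mA AO _] := rA; have [mB BO _] := rB.
have e20 : 0 < e / 2 by rewrite divr_gt0.
have := lB _ e20; have := lA _ e20; apply: filterS2 => m hA hB.
have UO : A `|` B `<=` Omega by move=> x [/AO|/BO].
rewrite !(ge0_integral_setU mu mA mB)//.
- apply: le_trans (leeD hA hB) _.
  move: (\int[mu]_(x in A) _)%E (\int[mu]_(x in B) _)%E => X Y.
  by rewrite addeACA -EFinD -splitr.
- exact: energy_measurable.
- by move=> x /UO Ox; rewrite lee_fin hpos.
- exact: energy_measurable.
- by move=> x /UO Ox; rewrite lee_fin hpos.
Qed.

(** Cells are kept when their closure lies in [Omega], so that local integrability applies; they are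
    half-open, hence disjoint. *)
Definition cells (a h : R) (j : nat) : set R := [set x | exists i, [/\ (i < j)%N,
  `[grid a h i, grid a h i.+1] `<=` Omega & grid a h i < x <= grid a h i.+1]].

Lemma cells_regular_lsc a h j : 0 < h -> regular (cells a h j) /\ lsc_on (cells a h j).
Proof.
move=> h0; elim: j => [|j [rj lj]].
  have -> : cells a h 0 = set0 by apply/seteqP; split => // x [i []].
  split; last exact: lsc_on_set0.
  by split => // v _; exact: measurable_fun_set0.
have xy : grid a h j < grid a h j.+1 by rewrite gridS ltrDl.
have [sub|nsub] := pselect (`[grid a h j, grid a h j.+1] `<=` Omega); last first.
  suff -> : cells a h j.+1 = cells a h j by [].
  apply/seteqP;
    split => [x [i [ij iO xi]]|x [i [ij iO xi]]]; exists i; split => //.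
    move: ij; rewrite ltnS leq_eqVlt => /predU1P[ij|//].
    by case: nsub; rewrite -ij.
  exact: leqW.
have E : cells a h j.+1 = cells a h j `|` `]grid a h j, grid a h j.+1].
  apply/seteqP; split => [x [i [ij iO xi]]|x [[i [ij iO xi]]|xj]].
  - move: ij; rewrite ltnS leq_eqVlt => /predU1P[ij|ij]; last by left; exists i.
    by right; rewrite -ij /= in_itv.
  - by exists i; split => //; exact: leqW.
  - by exists j; split => //; move: xj; rewrite /= in_itv.
have ri : regular `]grid a h j, grid a h j.+1].
  split => //; first by move=> x /subset_itv_oc_cc; exact: sub.
  by move=> v vi; exact: loc_integrable_measurable vi sub.
have [mj jO jm] := rj; have [mi iO im] := ri.
have rU : regular (cells a h j `|` `]grid a h j, grid a h j.+1]).
  split; first exact: measurableU.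
    by move=> x [/jO|/iO].
  by move=> v vi; apply/measurable_funU => //; split; [exact: jm|exact: im].
rewrite E; split => //; apply: lsc_on_setU => //; last exact: lsc_on_itv.
apply/disj_setPS => x [[i [ij _ /andP[_ xi]]]]; rewrite /= in_itv/= => /andP[jx _].
by have := lt_le_trans jx xi; rewrite ltNge (grid_le a (ltW h0) ij).
Qed.

Lemma grid_cell (a h x : R) N : 0 < h -> a < x <= grid a h N ->
  exists2 i, (i < N)%N & grid a h i < x <= grid a h i.+1.
Proof.
move=> h0; elim: N => [|N IH] /andP[ax xN].
  by move: xN; rewrite grid0 leNgt ax.
have [xN'|Nx] := leP x (grid a h N); last by exists N => //; rewrite Nx.
by have [|i iN xi] := IH; [rewrite ax|exists i => //; exact: leqW].
Qed.

(** Mesh [1 / (n + 1)] on []-(n + 1), n + 1]], whence [2 * (n + 1)^2] cells. These sets need not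
    increase with [n]; each point of [Omega] eventually belongs to all of them. *)
Definition exhaustion n := cells (- n.+1%:R) (n.+1%:R^-1) (2 * n.+1 * n.+1)%N.

Lemma exhaustion_cover x : Omega x -> \forall n \near \oo, exhaustion n x.
Proof.
move=> Ox; have /nbhs_ballP[r /= r0 Hr] := hOmega Ox.
near=> n; have n0 : 0 < n.+1%:R :> R by rewrite ltr0n.
have h0 : 0 < n.+1%:R^-1 :> R by rewrite invr_gt0.
have hr : n.+1%:R^-1 < r by near: n; exact: (near_infty_natSinv_lt (PosNum r0)).
have xn : `|x| < n.+1%:R.
  near: n; exists (Num.truncn `|x|) => // n /= xn.
  by apply: lt_le_trans (truncnS_gt _) _; rewrite ler_nat ltnS.
have gE : grid (- n.+1%:R) (n.+1%:R^-1 : R) (2 * n.+1 * n.+1) = n.+1%:R.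
  transitivity (- n.+1%:R + 2 * n.+1%:R : R); last by ring.
  rewrite /grid; congr (_ + _); rewrite -[LHS]mulr_natr !natrM mulrC mulfK ?gt_eqF//.
have [|i iN xi] := @grid_cell (- n.+1%:R) (n.+1%:R^-1) x (2 * n.+1 * n.+1)%N h0.
  by move: xn; rewrite gE ltr_norml => /andP[-> /ltW].
exists i; split => //.
move=> y; rewrite /= in_itv/= => /andP[y1 y2]; apply: Hr.
move: hr xi y1 y2; rewrite gridS /ball/=.
move: (n.+1%:R^-1) (grid _ _ i) => h g hr /andP[x1 x2] y1 y2.
by rewrite ltr_norml; apply/andP; split; lra.
Unshelve. all: by end_near. Qed.

Lemma regular_Omega : regular Omega.
Proof.
have hn n : 0 < n.+1%:R^-1 :> R by rewrite invr_gt0 ltr0n.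
have rD n := (@cells_regular_lsc (- n.+1%:R) _ (2 * n.+1 * n.+1) (hn n)).1.
have E : Omega = \bigcup_n exhaustion n.
  apply/seteqP; split => [x Ox|x [n _]]; last by have [_ + _] := rD n; exact.
  by have [n _ Hn] := exhaustion_cover Ox; exists n => //; apply: Hn => /=.
split => //; first exact: open_measurable.
move=> v vi; rewrite E; apply/measurable_fun_bigcup => [n|n].
  by have [] := rD n.
by have [_ _ /(_ v vi)] := rD n.
Qed.

Lemma limn_einf_ge (w : nat -> \bar R) (c : \bar R) :
  (\forall m \near \oo, (c <= w m)%E) -> (c <= limn_einf w)%E.
Proof.
move=> [N _ HN]; rewrite limn_einf_lim; apply: lime_ge; first exact: is_cvg_einfs.
exists N => // n /= Nn; apply: le_ereal_inf_tmp => _ [k /= nk <-].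
by apply: HN => /=; exact: leq_trans nk.
Qed.

Lemma limn_einf_le (w : nat -> \bar R) (c : \bar R) :
  (forall m, (w m <= c)%E) -> (limn_einf w <= c)%E.
Proof.
move=> H; rewrite limn_einf_lim; apply: lime_le; first exact: is_cvg_einfs.
exists 0%N => // n _; apply: le_trans (H n); apply: ereal_inf_lbound.
by exists n => /=.
Qed.

(** On each [exhaustion n] the energy of [u] is at most the lower limit, since [f >= 0] bounds the
    energy of [um m] there by the one on [Omega]. As the sets may fail to increase, Fatou's lemma,
    and not monotone convergence, carries the bound to [Omega]. *)
Lemma lsc_localization :
  (Ffun f Omega u du <= limn_einf (fun m => Ffun f Omega (um m) (dum m)))%E.
Proof.
set L := limn_einf _.
have [mO _ _] := regular_Omega.
have hn n : 0 < n.+1%:R^-1 :> R by rewrite invr_gt0 ltr0n.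
have mF v dv := @energy_measurable Omega v dv regular_Omega.
have pos0 (v dv : R -> R) x : Omega x -> (0 <= (f x (v x) (dv x))%:E)%E.
  by move=> Ox; rewrite lee_fin hpos.
have HD n : (\int[mu]_(x in exhaustion n) (f x (u x) (du x))%:E <= L)%E.
  have [[mD DO _] lD] := @cells_regular_lsc (- n.+1%:R) _ (2 * n.+1 * n.+1) (hn n).
  apply/lee_addgt0Pr => e e0; rewrite -leeBlDr//; apply: limn_einf_ge.
  have := lD e e0; apply: filterS => m Hm; rewrite leeBlDr//.
  apply: le_trans Hm _; apply: leeD => //.
  apply: ge0_subset_integral => //; first exact: mF.
  by move=> x; exact: pos0.
pose g n := (fun x => (f x (u x) (du x))%:E) \_ (exhaustion n).
have mg n : measurable_fun Omega (g n).
  have [[mD DO _] _] := @cells_regular_lsc (- n.+1%:R) _ (2 * n.+1 * n.+1) (hn n).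
  apply/measurable_restrict => //; apply: measurable_funS (mF _ _ hu) => //.
have g0 n x : Omega x -> (0 <= g n x)%E.
  by move=> Ox; rewrite /g patchE; case: ifP => // _; exact: pos0.
have gl x : Omega x -> limn_einf (g ^~ x) = (f x (u x) (du x))%:E.
  move=> Ox; have cg : g n x @[n --> \oo] --> (f x (u x) (du x))%:E.
    have E : \forall n \near \oo, (f x (u x) (du x))%:E = g n x.
      have := exhaustion_cover Ox; apply: filterS => n nx.
      by rewrite /g patchE mem_set.
    by apply: cvg_trans (near_eq_cvg E) _; exact: cvg_cst.
  by rewrite (cvg_limn_einf_sup cg).
rewrite /Ffun.
have -> : (\int[mu]_(x in Omega) (f x (u x) (du x))%:E =
   \int[mu]_(x in Omega) limn_einf (g ^~ x))%E.
  by apply: eq_integral => x; rewrite inE => Ox; rewrite gl.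
apply: le_trans (fatou mu mO mg g0) _; apply: limn_einf_le => n.
rewrite -integral_mkcondr; apply: le_trans (HD n).
have [[_ DO _] _] := @cells_regular_lsc (- n.+1%:R) _ (2 * n.+1 * n.+1) (hn n).
by rewrite setIidr.
Qed.

End sequence.
End localization.

Theorem theorem1p4 (R : realType) (Omega : set R) (f : R -> R -> R -> R)
  (hOmega : open Omega)
  (hpos : forall x s xi, Omega x -> 0 <= f x s xi)
  (* (H1) *)
  (hcont : {within [set p : R * R * R | Omega p.1.1],
             continuous (fun p : R * R * R => f p.1.1 p.1.2 p.2)})
  (hconv : forall x s, Omega x -> forall (t a b : R), 0 <= t -> t <= 1 ->
             f x s (t * a + (1 - t) * b) <= t * f x s a + (1 - t) * f x s b)
  (* (H2) *)
  (hder : forall x s xi, Omega x -> derivable (f x s) xi 1)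
  (hdercont : {within [set p : R * R * R | Omega p.1.1],
             continuous (fun p : R * R * R => fxi f p.1.1 p.1.2 p.2)})
  (hAC : forall (O' H K : set R), compact O' -> O' `<=` Omega ->
           compact H -> compact K ->
           forall eps : R, 0 < eps -> exists2 delta : R, 0 < delta &
             forall s xi, H s -> K xi ->
             forall (N : nat) (a b : nat -> R),
               (forall i, (i < N)%N -> a i < b i /\ `]a i, b i[ `<=` O') ->
               (forall i j, (i < N)%N -> (j < N)%N -> i <> j ->
                  `]a i, b i[ `&` `]a j, b j[ = set0) ->
               \sum_(i < N) (b i - a i) < delta ->
               \sum_(i < N) `|fxi f (b i) s xi - fxi f (a i) s xi| < eps)
  (* (H3) *)
  (hLip : forall K1 : set (R * R), compact K1 -> K1 `<=` [set p | Omega p.1] ->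
           exists L1 : R,
             (forall x s xi, K1 (x, s) -> `|fxi f x s xi| <= L1) /\
             (forall x s xi1 xi2, K1 (x, s) ->
                `|fxi f x s xi1 - fxi f x s xi2| <= L1 * `|xi1 - xi2|))
  (um dum : nat -> R -> R) (u du : R -> R)
  (hum : forall m, W11loc_with_deriv Omega (um m) (dum m))
  (hu : W11loc_with_deriv Omega u du)
  (hcvg : cvg_L1loc Omega um u) :
  (Ffun f Omega u du <= limn_einf (fun m => Ffun f Omega (um m) (dum m)))%E.
Proof.
have hcontp := within_fiber_continuous hOmega hcont.
have hint a b (v w : R -> R) :=
  @integrand_integrable R Omega f hOmega hpos hcont hconv hder hLip a b v w.
have hbound a b (v w : R -> R) :=
  @primitive_lower_bound R Omega f hOmega hpos hcont hconv hder hdercont hLip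
    hAC a b v w.
exact: (lsc_localization hOmega hpos hcontp hint hbound hum hu hcvg).
Qed.
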